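(* There are non-split $\Pi$-invertible sheaves on $\mathbb{P}^{1|m}$ if and only if $m>2$.
   Context: $\mathbb{P}^{1|m}$ is the complex projective superspace of dimension $1|m$, covered by two affine charts with coordinates $(z|\theta_1,\ldots,\theta_m)$ and $(w|\psi_1,\ldots,\psi_m)$ related by $z=1/w$, $\theta_i=\psi_i/w$. On a supermanifold $\mathcal{M}$, a $\Pi$-invertible sheaf is a locally-free sheaf $\mathcal{L}_\Pi$ of $\mathcal{O}_{\mathcal{M}}$-modules of rank $1|1$ endowed with an odd endomorphism $\Pi:\mathcal{L}_\Pi\to\mathcal{L}_\Pi$ exchanging its even and odd parts (a $\Pi$-symmetry, $\Pi^2=\mathrm{id}$). Isomorphism classes of $\Pi$-invertible sheaves form the pointed set $\mathrm{Pic}_\Pi(\mathcal{M})\cong H^1(\mathcal{O}^*_{\mathcal{M}})$, where $\mathcal{O}^*_{\mathcal{M}}$ is the sheaf of (in general non-abelian) groups of all invertible sections of $\mathcal{O}_{\mathcal{M}}$. A $\Pi$-invertible sheaf is split if it is isomorphic to $\mathcal{L}\oplus\Pi\mathcal{L}$ (with $\Pi$ exchanging the two summands) for some locally-free sheaf $\mathcal{L}$ of rank $1|0$; the map $\mathcal{L}\mapsto\mathcal{L}\oplus\Pi\mathcal{L}$ is the map $\mathrm{Pic}_0(\mathcal{M})=H^1(\mathcal{O}^*_{\mathcal{M},0})\to\mathrm{Pic}_\Pi(\mathcal{M})$ induced by the inclusion of the even invertible sections $\mathcal{O}^*_{\mathcal{M},0}\subset\mathcal{O}^*_{\mathcal{M}}$.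 *)

(* Defs.v *)
From HB Require Import structures.
From mathcomp Require Import all_boot all_order all_algebra.
From mathcomp Require Import mathcomp_extra boolp classical_sets functions.
From mathcomp Require Import topology.

Set Implicit Arguments.
Unset Strict Implicit.
Unset Printing Implicit Defensive.

Import GRing.Theory.

Local Open Scope ring_scope.

(* The exterior algebra on theta_0, ..., theta_(m-1): x I is the coefficient of
   the monomial theta^I, the product of the theta_i, i \in I, in increasing
   order. *)
Definition exterior (K : comNzRingType) (m : nat) : Type :=
  {ffun {set 'I_m} -> K}.

Section Exterior.
Import mathcomp.boot.finset.
Variables (K : comNzRingType) (m : nat).
Implicit Types (I J L N : {set 'I_m}) (x y z : exterior K m).

HB.instance Definition _ := GRing.Zmodule.copy (exterior K m)
  {ffun {set 'I_m} -> K}.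

Definition coef x I : K := (x : {ffun {set 'I_m} -> K}) I.

(* theta^J theta^L = (-1)^(inversions J L) theta^(J :|: L) for disjoint J, L *)
Definition inversions J L : nat := \sum_(j in J) \sum_(l in L) (l < j)%N.

Definition ext_one : exterior K m := [ffun I => (I == set0)%:R].

Definition ext_mul x y : exterior K m := [ffun I : {set 'I_m} =>
  \sum_(J : {set 'I_m} | J \subset I)
    (-1) ^+ inversions J (I :\: J) * (coef x J * coef y (I :\: J))].

Lemma extP x y : (forall I, coef x I = coef y I) -> x = y.
Proof. by move=> h; apply/ffunP. Qed.

Lemma coefD x y I : coef (x + y) I = coef x I + coef y I.
Proof. by rewrite /coef ffunE. Qed.

Lemma coefN x I : coef (- x) I = - coef x I.
Proof. by rewrite /coef ffunE. Qed.

Lemma coef0 I : coef (0 : exterior K m) I = 0.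
Proof. by rewrite /coef ffunE. Qed.

Lemma inversionsUl J L N : [disjoint J & L] ->
  inversions (J :|: L) N = (inversions J N + inversions L N)%N.
Proof.
move=> d; rewrite /inversions (eq_bigl _ _ (fun j => in_setU j J L)).
exact: bigU.
Qed.

Lemma inversionsUr J L N : [disjoint L & N] ->
  inversions J (L :|: N) = (inversions J L + inversions J N)%N.
Proof.
move=> d; rewrite /inversions -big_split /=; apply: eq_bigr => j _.
by rewrite (eq_bigl _ _ (fun j => in_setU j L N)); apply: bigU.
Qed.

Lemma inversions_swap J L : [disjoint J & L] ->
  (inversions J L + inversions L J = #|J| * #|L|)%N.
Proof.
move=> d; rewrite {2}/inversions exchange_big /= -big_split /=.
rewrite -sum_nat_const; apply: eq_bigr => j jJ.
rewrite -big_split /= -sum1_card; apply: eq_bigr => l lL.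
have ne : val j != val l.
  by apply: contraTneq lL => /val_inj <-; rewrite (disjointFr d jJ).
by case: ltngtP ne.
Qed.

Lemma inversions0l J : inversions set0 J = 0%N.
Proof. by rewrite /inversions big_set0. Qed.

Lemma inversions0r J : inversions J set0 = 0%N.
Proof. by rewrite /inversions big1 // => j _; rewrite big_set0. Qed.

Fact ext_mul1x : left_id ext_one ext_mul.
Proof.
move=> x; apply/extP => I; rewrite /coef ffunE (bigD1 set0) ?sub0set //=.
rewrite inversions0l setD0 expr0 mul1r big1 ?addr0 /coef ?ffunE ?eqxx ?mul1r //.
by move=> J /andP[_ /negPf J0]; rewrite ffunE J0 mul0r mulr0.
Qed.

Fact ext_mulx1 : right_id ext_one ext_mul.
Proof.
move=> x; apply/extP => I; rewrite /coef ffunE (bigD1 I) //=.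
rewrite setDv inversions0r expr0 mul1r big1 ?addr0 /coef ?ffunE ?eqxx ?mulr1 //.
move=> J /andP[JI nJI]; rewrite ffunE setD_eq0.
suff /negPf -> : ~~ (I \subset J) by rewrite !mulr0.
by apply: contra nJI => IJ; rewrite eqEsubset JI.
Qed.

Lemma disjointDl I J : [disjoint J & I :\: J].
Proof. by rewrite -setI_eq0 setIDA setIC -setIDA setDv setI0. Qed.

Fact ext_mulA : associative ext_mul.
Proof.
move=> x y z; apply/extP => I; rewrite /coef !ffunE.
rewrite [RHS](eq_bigr (fun L => \sum_(J : {set 'I_m} | J \subset L)
   (-1) ^+ inversions L (I :\: L) * ((-1) ^+ inversions J (L :\: J) *
     (coef x J * coef y (L :\: J)) * coef z (I :\: L)))); last first.
  by move=> L _; rewrite {1}/coef ffunE mulr_suml mulr_sumr.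
rewrite (exchange_big_dep (fun J : {set 'I_m} => J \subset I)) /=; last first.
  by move=> L J LI /fintype.subset_trans; apply.
apply: eq_bigr => J JI.
rewrite [RHS](reindex_onto (fun N : {set 'I_m} => J :|: N)
  (fun L => L :\: J)) /=; last first.
  move=> L /andP[_ JL]; apply/setP => i; rewrite !inE.
  by case: (boolP (i \in J)) => //= /(fintype.subsetP JL) ->.
rewrite {2}/coef ffunE !mulr_sumr; apply: eq_big => [N|N].
  rewrite subUset JI subsetUl andbT /= setDUl setDv set0U subsetD.
  by congr andb; apply/idP/eqP => [/setDidPl|/setDidPl].
rewrite subsetD => /andP[NI dNJ].
have -> : (J :|: N) :\: J = N.
  by rewrite setDUl setDv set0U; apply/setDidPl.
have -> : (I :\: J) :\: N = I :\: (J :|: N) by rewrite setDDl.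
set M := I :\: (J :|: N).
have dNM : [disjoint N & M].
  by rewrite /M -setDDl; apply: disjointDl.
have -> : I :\: J = N :|: M.
  apply/setP => i; rewrite !inE negb_or; case: (boolP (i \in N)) => iN /=.
    by rewrite (fintype.subsetP NI _ iN) (disjointFr dNJ iN).
  by rewrite andbT.
have dJN : [disjoint J & N] by rewrite disjoint_sym.
rewrite inversionsUl // inversionsUr // !exprD.
move: ((-1) ^+ _) ((-1) ^+ inversions J M) ((-1) ^+ inversions N M) => a b c.
rewrite -!mulrA (mulrCA (coef x J) c) (mulrCA a b) (mulrCA a c).
by rewrite (mulrCA b c).
Qed.

Fact ext_mulDl : left_distributive ext_mul +%R.
Proof.
move=> x y z; apply/extP => I; rewrite coefD /coef !ffunE -big_split /=.
by apply: eq_bigr => J _; rewrite coefD mulrDl mulrDr.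
Qed.

Fact ext_mulDr : right_distributive ext_mul +%R.
Proof.
move=> x y z; apply/extP => I; rewrite coefD /coef !ffunE -big_split /=.
by apply: eq_bigr => J _; rewrite coefD !mulrDr.
Qed.

HB.instance Definition _ := GRing.Zmodule_isPzRing.Build (exterior K m)
  ext_mulA ext_mul1x ext_mulx1 ext_mulDl ext_mulDr.

Lemma coef1 I : coef (1 : exterior K m) I = (I == set0)%:R.
Proof. by rewrite /coef ffunE. Qed.

Lemma coefM x y I : coef (x * y) I = \sum_(J : {set 'I_m} | J \subset I)
  (-1) ^+ inversions J (I :\: J) * (coef x J * coef y (I :\: J)).
Proof. by rewrite /coef ffunE. Qed.

Definition ext_ev x : exterior K m :=
  [ffun I : {set 'I_m} => if odd #|I| then 0 else coef x I].

Lemma coef_ev x I : coef (ext_ev x) I = if odd #|I| then 0 else coef x I.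
Proof. by rewrite {1}/coef ffunE. Qed.

Fact ext_ev_additive : zmod_morphism ext_ev.
Proof.
move=> x y; apply/extP => I; rewrite coefD coefN !coef_ev coefD coefN.
by case: ifP; rewrite ?subr0.
Qed.
HB.instance Definition _ := GRing.isZmodMorphism.Build _ _ ext_ev
  ext_ev_additive.

Lemma ext_evP b x :
  ext_ev x = (if b then 0 else x) <->
  (forall I, odd #|I| != b -> coef x I = 0).
Proof.
split=> [|h].
  case: b => h I; have := congr1 (coef^~ I) h; rewrite /= coef_ev.
    by case: odd => //= -> _; rewrite coef0.
  by case: odd => //= <-.
apply/extP => I; rewrite coef_ev; have := h I.
by case: b {h}; case: odd => //= h; rewrite ?coef0 ?h.
Qed.

Fact ext_ev_idem x : ext_ev (ext_ev x) = ext_ev x.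
Proof. by apply/extP => I; rewrite !coef_ev; case: odd. Qed.

Fact ext_ev1 : ext_ev 1 = 1.
Proof.
apply/(ext_evP false) => I; rewrite coef1.
by case: (I =P set0) => [->|_ _ //]; rewrite cards0.
Qed.

Lemma card_subsetD I J : J \subset I -> #|I| = (#|J| + #|I :\: J|)%N.
Proof. by move=> /setIidPr JI; rewrite -(cardsID J I) JI. Qed.

Fact ext_grading b c x y :
  ext_ev x = (if b then 0 else x) -> ext_ev y = (if c then 0 else y) ->
  ext_ev (x * y) = if b (+) c then 0 else x * y.
Proof.
move=> /ext_evP hx /ext_evP hy; apply/ext_evP => I Ibc.
rewrite coefM big1 // => J JI.
have [Jb|/hx->] := eqVneq (odd #|J|) b; last by rewrite mul0r mulr0.
rewrite hy ?mulr0 //; apply: contraNneq Ibc => Jc.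
by rewrite (card_subsetD JI) oddD Jb Jc.
Qed.

Fact ext_comm b c x y :
  ext_ev x = (if b then 0 else x) -> ext_ev y = (if c then 0 else y) ->
  x * y = (-1) ^+ (b && c) * (y * x).
Proof.
move=> /ext_evP hx /ext_evP hy; apply/extP => I.
have -> : coef ((-1) ^+ (b && c) * (y * x)) I =
    (-1) ^+ (b && c) * coef (y * x) I.
  by case: (b && c); rewrite ?expr0 ?mul1r // expr1 !mulN1r coefN.
rewrite !coefM mulr_sumr.
rewrite [RHS](reindex_onto (fun J : {set 'I_m} => I :\: J)
  (fun J : {set 'I_m} => I :\: J)) /=; last first.
  by move=> J JI; rewrite setDDr setDv set0U; apply/setIidPr.
apply: eq_big => [J|J JI].
  by rewrite subsetDl setDDr setDv set0U; apply/idP/eqP => /setIidPr.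
have -> : I :\: (I :\: J) = J by rewrite setDDr setDv set0U; apply/setIidPr.
have [Jb|/hx->] := eqVneq (odd #|J|) b; last by rewrite mul0r !mulr0.
have [Jc|/hy->] := eqVneq (odd #|I :\: J|) c; last by rewrite mul0r !mulr0.
rewrite [coef y _ * _]mulrC mulrA; congr (_ * _).
rewrite -Jb -Jc -oddM -(inversions_swap (disjointDl I J)) signr_odd exprD.
by rewrite -mulrA -expr2 sqrr_sign mulr1.
Qed.

(* the algebra endomorphism induced by theta_i |-> t theta_i *)
Definition rescale (t : K) x : exterior K m :=
  [ffun I : {set 'I_m} => t ^+ #|I| * coef x I].

Lemma coef_rescale t x I : coef (rescale t x) I = t ^+ #|I| * coef x I.
Proof. by rewrite {1}/coef ffunE. Qed.

Fact rescale_additive t : zmod_morphism (rescale t).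
Proof.
move=> x y; apply/extP => I.
by rewrite coefD coefN !coef_rescale coefD coefN mulrBr.
Qed.
HB.instance Definition _ t := GRing.isZmodMorphism.Build _ _ (rescale t)
  (rescale_additive t).

Fact rescale_multiplicative t : monoid_morphism (rescale t).
Proof.
split=> [|x y]; apply/extP => I.
  rewrite coef_rescale coef1; case: eqP => [->|_]; last by rewrite mulr0.
  by rewrite cards0 expr0 mul1r.
rewrite coef_rescale !coefM mulr_sumr; apply: eq_bigr => J JI.
rewrite !coef_rescale (card_subsetD JI) exprD mulrCA; congr (_ * _).
by rewrite -!mulrA; congr (_ * _); rewrite mulrCA.
Qed.
HB.instance Definition _ t := GRing.isMonoidMorphism.Build _ _ (rescale t)
  (rescale_multiplicative t).

Lemma rescale_ev t x : rescale t (ext_ev x) = ext_ev (rescale t x).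
Proof.
apply/extP => I; rewrite !(coef_rescale, coef_ev).
by case: odd; rewrite ?mulr0.
Qed.

End Exterior.

Local Open Scope classical_set_scope.

(* A Z/2-grading V = V_0 + V_1 is given by the projection ev onto the even
   part along the odd part; b = true stands for odd. *)
Definition homogeneous (V : zmodType) (ev : V -> V) (b : bool) (x : V) : Prop :=
  ev x = if b then 0 else x.

Record superring := SuperRing {
  sring :> pzRingType;
  sring_ev : {additive sring -> sring};
  sring_ev_idem : forall x, sring_ev (sring_ev x) = sring_ev x;
  sring_1even : homogeneous sring_ev false 1;
  sring_grading : forall b c x y,
    homogeneous sring_ev b x -> homogeneous sring_ev c y ->
    homogeneous sring_ev (b (+) c) (x * y);
  sring_comm : forall b c x y,
    homogeneous sring_ev b x -> homogeneous sring_ev c y ->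
    x * y = (-1) ^+ (b && c) * (y * x)
}.

Record supermodule (A : superring) := SuperModule {
  smod :> lmodType A;
  smod_ev : {additive smod -> smod};
  smod_ev_idem : forall s, smod_ev (smod_ev s) = smod_ev s;
  smod_grading : forall b c (a : A) (s : smod),
    homogeneous (@sring_ev A) b a -> homogeneous smod_ev c s ->
    homogeneous smod_ev (b (+) c) (a *: s)
}.

Section ParityInvolution.
Variable A : superring.
Implicit Types a b : A.

(* a |-> (-1)^|a| a on homogeneous elements *)
Definition parity_sign a : A := sring_ev A a - (a - sring_ev A a).

Lemma homogeneous_ev a : homogeneous (@sring_ev A) false (sring_ev A a).
Proof. exact: sring_ev_idem. Qed.

Lemma homogeneous_odd a : homogeneous (@sring_ev A) true (a - sring_ev A a).
Proof. by rewrite /homogeneous raddfB sring_ev_idem subrr. Qed.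

Lemma parity_signE (c : bool) a :
  homogeneous (@sring_ev A) c a -> parity_sign a = (-1) ^+ c * a.
Proof.
rewrite /homogeneous /parity_sign => ->.
by case: c; rewrite ?subr0 ?sub0r ?expr1 ?mulN1r // subrr subr0 expr0 mul1r.
Qed.

Lemma sring_decomp a b :
  exists x0 x1 y0 y1, [/\ a = x0 + x1, b = y0 + y1,
    homogeneous (@sring_ev A) false x0 /\ homogeneous (@sring_ev A) true x1
  & homogeneous (@sring_ev A) false y0 /\ homogeneous (@sring_ev A) true y1].
Proof.
exists (sring_ev A a), (a - sring_ev A a), (sring_ev A b), (b - sring_ev A b).
by split; rewrite ?subrKC //; split;
  do [exact: homogeneous_ev | exact: homogeneous_odd].
Qed.

Lemma parity_signD a b : parity_sign (a + b) = parity_sign a + parity_sign b.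
Proof.
rewrite /parity_sign raddfD /= (opprD (sring_ev A a)) (addrACA a) opprD.
by rewrite addrACA.
Qed.

Lemma parity_signM a b : parity_sign (a * b) = parity_sign a * parity_sign b.
Proof.
have [x0 [x1 [y0 [y1 [-> -> [hx0 hx1] [hy0 hy1]]]]]] := sring_decomp a b.
have hM c d x y : homogeneous (@sring_ev A) c x ->
    homogeneous (@sring_ev A) d y ->
    parity_sign (x * y) = parity_sign x * parity_sign y.
  move=> hx hy; rewrite (parity_signE (sring_grading hx hy)).
  rewrite (parity_signE hx) (parity_signE hy).
  by case: c d {hx hy} => [] []; rewrite /= ?expr1 ?expr0 ?mul1r ?mulN1r
    ?mulNr ?mulrN ?opprK.
rewrite [(x0 + x1) * _]mulrDl 2!(mulrDr _ y0 y1) !parity_signD.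
rewrite (hM _ _ _ _ hx0 hy0) (hM _ _ _ _ hx0 hy1).
rewrite (hM _ _ _ _ hx1 hy0) (hM _ _ _ _ hx1 hy1).
by rewrite [RHS]mulrDl !(mulrDr _ (parity_sign y0)).
Qed.

Lemma parity_sign1 : parity_sign 1 = 1.
Proof. by rewrite (parity_signE (sring_1even A)) expr0 mul1r. Qed.

End ParityInvolution.

(* The parity shift Pi M: the underlying group of M with the two parities
   exchanged and a . s = (-1)^|a| a s. *)
Definition pshift_type (A : superring) (M : supermodule A) : Type := M.

Section ParityShift.
Variables (A : superring) (M : supermodule A).

HB.instance Definition _ := GRing.Zmodule.copy (pshift_type M) M.

Definition pshift_scale (a : A) (s : pshift_type M) : pshift_type M :=
  parity_sign a *: (s : M).

Fact pshift_scaleA a b (s : pshift_type M) :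
  pshift_scale a (pshift_scale b s) = pshift_scale (a * b) s.
Proof. by rewrite /pshift_scale scalerA parity_signM. Qed.

Fact pshift_scale1 : left_id 1 pshift_scale.
Proof. by move=> s; rewrite /pshift_scale parity_sign1 scale1r. Qed.

Fact pshift_scaleDr : right_distributive pshift_scale +%R.
Proof. by move=> a s t; rewrite /pshift_scale scalerDr. Qed.

Fact pshift_scaleDl (s : pshift_type M) :
  {morph pshift_scale^~ s : a b / a + b}.
Proof. by move=> a b; rewrite /pshift_scale parity_signD scalerDl. Qed.

HB.instance Definition _ := GRing.Zmodule_isLmodule.Build A (pshift_type M)
  pshift_scaleA pshift_scale1 pshift_scaleDr pshift_scaleDl.

Lemma pshift_scaleE (a : A) (s : pshift_type M) :
  a *: s = (parity_sign a *: (s : M) : pshift_type M).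
Proof. by []. Qed.

Definition pshift_ev (s : pshift_type M) : pshift_type M :=
  (s : M) - smod_ev M s.

Fact pshift_ev_additive : zmod_morphism pshift_ev.
Proof. by move=> s t; rewrite /pshift_ev raddfB /= !opprD addrACA. Qed.
HB.instance Definition _ :=
  GRing.isZmodMorphism.Build _ _ pshift_ev pshift_ev_additive.

Fact pshift_ev_idem s : pshift_ev (pshift_ev s) = pshift_ev s.
Proof. by rewrite /pshift_ev raddfB /= smod_ev_idem subrr subr0. Qed.

Lemma pshift_homogeneous b (s : pshift_type M) :
  homogeneous pshift_ev b s <-> homogeneous (@smod_ev A M) (~~ b) s.
Proof.
rewrite /homogeneous /pshift_ev; case: b => /=; split.
- by move/eqP; rewrite subr_eq0 => /eqP.
- by move=> ->; rewrite subrr.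
- by move/eqP; rewrite -subr_eq0 addrAC subrr add0r oppr_eq0 => /eqP.
- by move=> ->; rewrite subr0.
Qed.

Fact pshift_grading b c (a : A) (s : pshift_type M) :
  homogeneous (@sring_ev A) b a -> homogeneous pshift_ev c s ->
  homogeneous pshift_ev (b (+) c) (a *: s).
Proof.
move=> ha /pshift_homogeneous hs; apply/pshift_homogeneous.
rewrite pshift_scaleE (parity_signE ha) -addbN; apply: smod_grading => //.
by case: b ha => ha; rewrite ?expr0 ?expr1 ?mul1r ?mulN1r //
  /homogeneous raddfN /= ha oppr0.
Qed.

Definition pshift : supermodule A :=
  @SuperModule A (pshift_type M) pshift_ev pshift_ev_idem pshift_grading.

End ParityShift.

Section DirectSum.
Variables (A : superring) (M N : supermodule A).

Definition dsum_ev (s : M * N) : M * N := (smod_ev M s.1, smod_ev N s.2).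

Fact dsum_ev_additive : zmod_morphism dsum_ev.
Proof. by move=> s t; rewrite /dsum_ev !raddfB. Qed.
HB.instance Definition _ :=
  GRing.isZmodMorphism.Build _ _ dsum_ev dsum_ev_additive.

Fact dsum_ev_idem s : dsum_ev (dsum_ev s) = dsum_ev s.
Proof. by rewrite /dsum_ev !smod_ev_idem. Qed.

Lemma dsum_homogeneous b (s : M * N) : homogeneous dsum_ev b s <->
  homogeneous (@smod_ev A M) b s.1 /\ homogeneous (@smod_ev A N) b s.2.
Proof.
case: s => s t; rewrite /homogeneous /dsum_ev.
by case: b; split=> [[]|[/= -> ->]].
Qed.

Fact dsum_grading b c (a : A) (s : M * N) :
  homogeneous (@sring_ev A) b a -> homogeneous dsum_ev c s ->
  homogeneous dsum_ev (b (+) c) (a *: s).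
Proof.
move=> ha /dsum_homogeneous[h1 h2]; apply/dsum_homogeneous.
by split; apply: smod_grading.
Qed.

Definition dsum : supermodule A :=
  @SuperModule A (M * N)%type dsum_ev dsum_ev_idem dsum_grading.

End DirectSum.

Record opens (X : topologicalType) := Opens {
  oset :> set X;
  oset_open : open oset
}.

(* Ringed spaces in superrings. Functoriality is stated for arbitrary inclusion
   proofs, so that restrictions do not depend on them. *)
Record superspace := Superspace {
  space :> topologicalType;
  osec : opens space -> superring;
  ores : forall U V : opens space,
    V `<=` U -> {rmorphism osec U -> osec V};
  ores_id : forall (U : opens space) (UU : U `<=` U) a, ores UU a = a;
  ores_comp : forall (U V W : opens space)
      (VU : V `<=` U) (WV : W `<=` V) (WU : W `<=` U) a,
    ores WV (ores VU a) = ores WU a;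
  ores_ev : forall (U V : opens space) (VU : V `<=` U) a,
    sring_ev (osec V) (ores VU a) = ores VU (sring_ev (osec U) a);
  osec_glue : forall (U : opens space) (I : Type) (V : I -> opens space)
      (VU : forall i, V i `<=` U) (a : forall i, osec (V i)),
    U `<=` \bigcup_i V i ->
    (forall i j (W : opens space) (Wi : W `<=` V i) (Wj : W `<=` V j),
        ores Wi (a i) = ores Wj (a j)) ->
    exists! b : osec U, forall i, ores (VU i) b = a i
}.

Record module_sheaf (X : superspace) := ModuleSheaf {
  msec :> forall U : opens X, supermodule (osec U);
  mres : forall U V : opens X, V `<=` U -> {additive msec U -> msec V};
  mres_scale : forall (U V : opens X) (VU : V `<=` U) (a : osec U) s,
    mres VU (a *: s) = ores VU a *: mres VU s;
  mres_id : forall (U : opens X) (UU : U `<=` U) s, mres UU s = s;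
  mres_comp : forall (U V W : opens X)
      (VU : V `<=` U) (WV : W `<=` V) (WU : W `<=` U) s,
    mres WV (mres VU s) = mres WU s;
  mres_ev : forall (U V : opens X) (VU : V `<=` U) s,
    smod_ev (msec V) (mres VU s) = mres VU (smod_ev (msec U) s);
  msec_glue : forall (U : opens X) (I : Type) (V : I -> opens X)
      (VU : forall i, V i `<=` U) (s : forall i, msec (V i)),
    U `<=` \bigcup_i V i ->
    (forall i j (W : opens X) (Wi : W `<=` V i) (Wj : W `<=` V j),
        mres Wi (s i) = mres Wj (s j)) ->
    exists! t : msec U, forall i, mres (VU i) t = s i
}.

Arguments ores {s U V} VU.
Arguments mres {X m U V} VU.

Section SheafConstructions.
Variables (X : superspace) (F G : module_sheaf X).

Lemma parity_sign_res (U V : opens X) (VU : V `<=` U) (a : osec U) :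
  parity_sign (ores VU a) = ores VU (parity_sign a).
Proof. by rewrite /parity_sign !rmorphB /= ores_ev. Qed.

Definition pshift_res (U V : opens X) (VU : V `<=` U) :
  pshift (F U) -> pshift (F V) := mres VU.

Fact pshift_res_additive U V VU : zmod_morphism (@pshift_res U V VU).
Proof. by move=> s t; exact: (raddfB (mres VU)). Qed.
HB.instance Definition _ U V VU := GRing.isZmodMorphism.Build _ _
  (@pshift_res U V VU) (pshift_res_additive VU).

Definition pshift_sheaf : module_sheaf X.
Proof.
refine (@ModuleSheaf X (fun U => pshift (F U))
  (fun U V VU => @pshift_res U V VU) _ _ _ _ _).
- move=> U V VU a s; rewrite [LHS](mres_scale VU (parity_sign a)).
  by rewrite -parity_sign_res.
- exact: mres_id.
- exact: mres_comp.
- move=> U V VU s; rewrite [RHS](raddfB (mres VU)) /= -mres_ev //.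
- exact: msec_glue.
Defined.

Definition dsum_res (U V : opens X) (VU : V `<=` U) (s : dsum (F U) (G U)) :
  dsum (F V) (G V) := (mres VU s.1, mres VU s.2).

Fact dsum_res_additive U V VU : zmod_morphism (@dsum_res U V VU).
Proof. by move=> s t; rewrite /dsum_res !raddfB. Qed.
HB.instance Definition _ U V VU := GRing.isZmodMorphism.Build _ _
  (@dsum_res U V VU) (dsum_res_additive VU).

Definition dsum_sheaf : module_sheaf X.
Proof.
refine (@ModuleSheaf X (fun U => dsum (F U) (G U))
  (fun U V VU => @dsum_res U V VU) _ _ _ _ _).
- by move=> U V VU a s; congr pair; apply: mres_scale.
- by move=> U UU [s t]; congr pair; apply: mres_id.
- by move=> U V W VU WV WU [s t]; congr pair; apply: mres_comp.
- by move=> U V VU s; congr pair; apply: mres_ev.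
- move=> U I V VU s cov compat.
  have [t1 [h1 u1]] := msec_glue VU (s := fun i => (s i).1) cov
    (fun i j W Wi Wj => congr1 fst (compat i j W Wi Wj)).
  have [t2 [h2 u2]] := msec_glue VU (s := fun i => (s i).2) cov
    (fun i j W Wi Wj => congr1 snd (compat i j W Wi Wj)).
  exists (t1, t2); split=> [i|[t1' t2'] h'].
    by rewrite [s i]surjective_pairing -h1 -h2.
  by congr pair; [apply: u1 | apply: u2] => i; rewrite -h'.
Defined.

End SheafConstructions.

(* e, f form a homogeneous frame of F over U, i.e. they induce an isomorphism
   of O^{p|q} onto F over U. *)
Definition local_frame (X : superspace) (F : module_sheaf X) (U : opens X)
    (p q : nat) (e : 'I_p -> F U) (f : 'I_q -> F U) : Prop :=
  [/\ forall i, homogeneous (@smod_ev _ (F U)) false (e i),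
      forall j, homogeneous (@smod_ev _ (F U)) true (f j)
    & forall (V : opens X) (VU : V `<=` U) (s : F V),
        exists! c : ('I_p -> osec V) * ('I_q -> osec V),
          s = \sum_(i < p) c.1 i *: mres VU (e i)
            + \sum_(j < q) c.2 j *: mres VU (f j)].

Definition locally_free (X : superspace) (p q : nat) (F : module_sheaf X) :=
  forall x : X, exists U : opens X, oset U x /\
    exists (e : 'I_p -> F U) (f : 'I_q -> F U), local_frame e f.

(* Modules are left modules: an odd endomorphism is linear up to the sign
   Pi (a s) = (-1)^|a| a Pi s. *)
Record pi_symmetry (X : superspace) (F : module_sheaf X) := PiSymmetry {
  pisym :> forall U : opens X, {additive F U -> F U};
  pisym_res : forall (U V : opens X) (VU : V `<=` U) s,
    pisym V (mres VU s) = mres VU (pisym U s);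
  pisym_odd : forall (U : opens X) b s,
    homogeneous (@smod_ev _ (F U)) b s ->
    homogeneous (@smod_ev _ (F U)) (~~ b) (pisym U s);
  pisym_scale : forall (U : opens X) b (a : osec U) s,
    homogeneous (@sring_ev (osec U)) b a ->
    pisym U (a *: s) = ((-1) ^+ b * a) *: pisym U s;
  pisym_invol : forall (U : opens X) s, pisym U (pisym U s) = s
}.

Record pi_invertible_sheaf (X : superspace) := PiInvertible {
  pi_sheaf :> module_sheaf X;
  pi_rank : locally_free 1 1 pi_sheaf;
  pi_sym : pi_symmetry pi_sheaf
}.

Definition pi_isomorphic (X : superspace) (F G : module_sheaf X)
    (PF : pi_symmetry F) (PG : pi_symmetry G) : Prop :=
  exists phi : forall U : opens X, {linear F U -> G U},
    [/\ forall U, bijective (phi U),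
        forall (U V : opens X) (VU : V `<=` U) s,
          phi V (mres VU s) = mres VU (phi U s),
        forall U s, smod_ev (G U) (phi U s) = phi U (smod_ev (F U) s)
      & forall U s, phi U (PF U s) = PG U (phi U s)].

Section SplitSymmetry.
Variables (X : superspace) (L : module_sheaf X).
Let LL := dsum_sheaf L (pshift_sheaf L).

(* (s, t) |-> (t, s) is odd since t has opposite parities in L and in Pi L *)
Definition split_swap (U : opens X) (s : LL U) : LL U := (s.2, s.1).

Fact split_swap_additive U : zmod_morphism (@split_swap U).
Proof. by []. Qed.
HB.instance Definition _ U := GRing.isZmodMorphism.Build _ _
  (@split_swap U) (@split_swap_additive U).

Definition split_symmetry : pi_symmetry LL.
Proof.
refine (@PiSymmetry X LL (fun U => @split_swap U) _ _ _ _) => //.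
- move=> U b [s t] hst.
  have [/= hs /pshift_homogeneous ht] :=
    (@dsum_homogeneous _ (L U) (pshift (L U)) b (s, t)).1 hst.
  apply: (@dsum_homogeneous _ (L U) (pshift (L U)) (~~ b) (t, s)).2.
  by split => //=; apply/pshift_homogeneous; rewrite negbK.
- move=> U b a [s t] ha; congr pair => /=.
    by rewrite pshift_scaleE (parity_signE ha).
  rewrite pshift_scaleE.
  have -> : parity_sign ((-1) ^+ b * a) = a; last by [].
  rewrite (@parity_signE _ b); last by
    case: b ha => ha; rewrite ?expr0 ?expr1 ?mul1r ?mulN1r //
    /homogeneous raddfN /= ha oppr0.
  by rewrite mulrA -exprD addnn -signr_odd odd_double mul1r.
- by move=> U [].
Defined.

End SplitSymmetry.

Definition pi_split (X : superspace) (E : pi_invertible_sheaf X) : Prop :=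
  exists L : module_sheaf X,
    locally_free 1 0 L /\ pi_isomorphic (pi_sym E) (split_symmetry L).

(* Zariski topology and regular functions on the affine line. Only K-points are
   considered, so that K is meant to be algebraically closed. *)
Definition zariski_open (K : fieldType) (X : set K) : Prop :=
  exists S : set {poly K}, X = [set x | exists2 p, S p & p.[x] != 0].

Definition regular (K : fieldType) (X : set K) (f : X -> K) : Prop :=
  forall a : X, exists p q : {poly K},
    q.[val a] != 0 /\
    forall x : X, q.[val x] != 0 -> f x = p.[val x] / q.[val x].

(* P^1: Some z is the point of coordinate z, None is the point z = oo. *)
Definition proj_line (K : fieldType) : Type := option K.

Section ProjectiveLine.
Variable K : fieldType.

HB.instance Definition _ := Choice.copy (proj_line K) (option K).

Definition chart_z (z : K) : proj_line K := Some z.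
Definition chart_w (w : K) : proj_line K :=
  if w == 0 then None else Some w^-1.

Definition proj_line_open (U : set (proj_line K)) : Prop :=
  zariski_open (chart_z @^-1` U) /\ zariski_open (chart_w @^-1` U).

Lemma zariski_openT : zariski_open [set: K].
Proof.
exists setT; apply/seteqP; split=> x _ //.
by exists 1 => //; rewrite hornerC oner_neq0.
Qed.

Lemma zariski_openI (X Y : set K) :
  zariski_open X -> zariski_open Y -> zariski_open (X `&` Y).
Proof.
move=> [S ->] [T ->].
exists [set p * q | p in S & q in T]; apply/seteqP; split=> x /=.
  move=> [[p Sp px] [q Tq qx]]; exists (p * q).
    by exists p => //; exists q.
  by rewrite hornerM mulf_neq0.
move=> [_ [p Sp [q Tq <-]]]; rewrite hornerM mulf_eq0 negb_or.
by move=> /andP[px qx]; split; [exists p | exists q].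
Qed.

Lemma zariski_open_bigU (I : Type) (X : I -> set K) :
  (forall i, zariski_open (X i)) -> zariski_open (\bigcup_i X i).
Proof.
move=> /choice[S hS]; exists (\bigcup_i S i); apply/seteqP; split=> x /=.
  by move=> [i _]; rewrite hS => -[p Sp px]; exists p => //; exists i.
by move=> [p [i _ Sp] px]; exists i => //; rewrite hS; exists p.
Qed.

Fact proj_line_openT : proj_line_open setT.
Proof. by split; rewrite preimage_setT; apply: zariski_openT. Qed.

Fact proj_line_openI : setI_closed proj_line_open.
Proof.
move=> U V [U0 U1] [V0 V1].
by split; rewrite preimage_setI; apply: zariski_openI.
Qed.

Fact proj_line_open_bigU (I : Type) (f : I -> set (proj_line K)) :
  (forall i, proj_line_open (f i)) -> proj_line_open (\bigcup_i f i).
Proof.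
move=> h; split; rewrite preimage_bigcup; apply: zariski_open_bigU => i;
by have [] := h i.
Qed.

HB.instance Definition _ := isOpenTopological.Build (proj_line K)
  proj_line_openT proj_line_openI proj_line_open_bigU.

Lemma proj_line_openE (U : set (proj_line K)) : open U = proj_line_open U.
Proof. by []. Qed.

Section Regular.
Variable X : set K.

Lemma regular_cst (c : K) : regular ((fun=> c) : X -> K).
Proof.
move=> a; exists c%:P, 1; rewrite hornerC oner_neq0; split=> // x _.
by rewrite !hornerC divr1.
Qed.

Lemma regularD (f g : X -> K) :
  regular f -> regular g -> regular (fun x => f x + g x).
Proof.
move=> hf hg a; have [p [q [qa fE]]] := hf a; have [r [s [sa gE]]] := hg a.
exists (p * s + r * q), (q * s); rewrite hornerM mulf_neq0 //; split=> // x.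
rewrite hornerM mulf_eq0 negb_or => /andP[qx sx].
by rewrite fE // gE // hornerD !hornerM addf_div.
Qed.

Lemma regularM (f g : X -> K) :
  regular f -> regular g -> regular (fun x => f x * g x).
Proof.
move=> hf hg a; have [p [q [qa fE]]] := hf a; have [r [s [sa gE]]] := hg a.
exists (p * r), (q * s); rewrite hornerM mulf_neq0 //; split=> // x.
rewrite hornerM mulf_eq0 negb_or => /andP[qx sx].
by rewrite fE // gE // !hornerM mulf_div.
Qed.

Lemma regular_sum (I : Type) (r : seq I) (P : pred I) (f : I -> X -> K) :
  (forall i, P i -> regular (f i)) ->
  regular (fun x => \sum_(i <- r | P i) f i x).
Proof.
move=> h; elim: r => [|i r IH].
  by under eq_fun do rewrite big_nil; apply: regular_cst.
under eq_fun do rewrite big_cons; case: (boolP (P i)) => // Pi.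
by apply: regularD => //; apply: h.
Qed.

Variable m : nat.

(* sections over X of the structure sheaf of the affine superline A^{1|m} *)
Definition super_regular (f : X -> exterior K m) : Prop :=
  forall I, regular (fun x => coef (f x) I).

Lemma super_regular_cst c : super_regular ((fun=> c) : X -> exterior K m).
Proof. by move=> I; apply: regular_cst. Qed.

Lemma super_regularB f g :
  super_regular f -> super_regular g -> super_regular (f - g).
Proof.
move=> hf hg I.
under eq_fun => x do rewrite [(f - g) x]/(f x - g x) coefD coefN -mulN1r.
by apply: regularD => //; apply: regularM => //; apply: regular_cst.
Qed.

Lemma super_regularM f g :
  super_regular f -> super_regular g -> super_regular (f * g).
Proof.
move=> hf hg I.
under eq_fun => x do rewrite [(f * g) x]/(f x * g x) coefM.
apply: regular_sum => J _; apply: regularM; first exact: regular_cst.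
exact: regularM.
Qed.

Lemma super_regular_ev f :
  super_regular f -> super_regular (fun x => ext_ev (f x)).
Proof.
move=> hf I; under eq_fun do rewrite coef_ev.
by case: odd; [exact: regular_cst | exact: hf].
Qed.

End Regular.

Variable m : nat.

Definition chart_sections (U : set (proj_line K)) : Type :=
  (((chart_z @^-1` U) -> exterior K m) *
   ((chart_w @^-1` U) -> exterior K m))%type.

HB.instance Definition _ U := GRing.PzRing.on (chart_sections U).

(* Sections over U of the structure sheaf of P^{1|m}: a superfunction f.1 of
   (z | theta) and a superfunction f.2 of (w | psi) which agree on the overlap
   z = w^-1, theta_i = psi_i / w = z psi_i. *)
Definition glued (U : set (proj_line K)) (f : chart_sections U) : Prop :=
  [/\ super_regular f.1, super_regular f.2 &
      forall (z : chart_z @^-1` U) (w : chart_w @^-1` U),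
        val z * val w = 1 -> f.2 w = rescale (val z) (f.1 z)].

Definition glued_pred U : {pred chart_sections U} := fun f => `[< glued f >].

Fact glued_subring U : subring_closed (@glued_pred U).
Proof.
split.
- apply/asboolP; split; [exact: super_regular_cst..|].
  by move=> z w _; rewrite [RHS]rmorph1.
- move=> f g /asboolP[f1 f2 f12] /asboolP[g1 g2 g12]; apply/asboolP; split.
  + exact: super_regularB.
  + exact: super_regularB.
  + move=> z w zw; rewrite [LHS]/(f.2 w - g.2 w) (f12 _ _ zw) (g12 _ _ zw).
    by rewrite [RHS]raddfB.
- move=> f g /asboolP[f1 f2 f12] /asboolP[g1 g2 g12]; apply/asboolP; split.
  + exact: super_regularM.
  + exact: super_regularM.
  + move=> z w zw; rewrite [LHS]/(f.2 w * g.2 w) (f12 _ _ zw) (g12 _ _ zw).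
    by rewrite [RHS]rmorphM.
Qed.

Record proj_section U := ProjSection {
  proj_val :> chart_sections U;
  _ : proj_val \in @glued_pred U
}.

HB.instance Definition _ U := [isSub for @proj_val U].
HB.instance Definition _ U := [Choice of proj_section U by <:].
HB.instance Definition _ U := GRing.SubChoice_isSubPzRing.Build
  (chart_sections U) (@glued_pred U) (proj_section U) (glued_subring U).

Lemma proj_sectionP U (f : proj_section U) : glued f.
Proof. by apply/asboolP; case: f. Qed.

Definition mk_section U (f : chart_sections U) (hf : glued f) :
  proj_section U :=
  ProjSection (introT (asboolP _) hf).

Lemma proj_section_eq U (f g : proj_section U) :
  (forall z, (proj_val f).1 z = (proj_val g).1 z) ->
  (forall w, (proj_val f).2 w = (proj_val g).2 w) -> f = g.
Proof.
move=> h1 h2; apply: val_inj; rewrite /= [LHS]surjective_pairing.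
by rewrite [RHS]surjective_pairing; congr pair; apply/funext.
Qed.

Fact proj_ev_glued U (f : proj_section U) :
  glued ((fun z => ext_ev ((proj_val f).1 z),
          fun w => ext_ev ((proj_val f).2 w)) : chart_sections U).
Proof.
have [f1 f2 f12] := proj_sectionP f.
split; [exact: super_regular_ev..|] => z w zw /=.
by rewrite (f12 _ _ zw) rescale_ev.
Qed.
Definition proj_ev U (f : proj_section U) : proj_section U :=
  mk_section (proj_ev_glued f).

Fact proj_ev_additive U : zmod_morphism (@proj_ev U).
Proof. by move=> f g; apply: proj_section_eq => x; exact: raddfB. Qed.
HB.instance Definition _ U := GRing.isZmodMorphism.Build _ _ (@proj_ev U)
  (@proj_ev_additive U).

Lemma proj_homogeneous U b (f : proj_section U) : homogeneous (@proj_ev U) b f ->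
  (forall z, homogeneous (@ext_ev K m) b ((proj_val f).1 z)) /\
  (forall w, homogeneous (@ext_ev K m) b ((proj_val f).2 w)).
Proof.
move=> h; split=> x; rewrite /homogeneous.
  by have := congr1 (fun g : proj_section U => (proj_val g).1 x) h; case: (b).
by have := congr1 (fun g : proj_section U => (proj_val g).2 x) h; case: (b).
Qed.

Definition proj_superring (U : set (proj_line K)) : superring.
Proof.
refine (@SuperRing (proj_section U) (@proj_ev U) _ _ _ _).
- by move=> f; apply: proj_section_eq => x; exact: ext_ev_idem.
- by apply: proj_section_eq => x; exact: ext_ev1.
- move=> b c f g /proj_homogeneous[f1 f2] /proj_homogeneous[g1 g2].
  apply: proj_section_eq => x; rewrite /homogeneous.
    by rewrite [LHS](ext_grading (f1 x) (g1 x)); case: (_ (+) _).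
  by rewrite [LHS](ext_grading (f2 x) (g2 x)); case: (_ (+) _).
- move=> b c f g /proj_homogeneous[f1 f2] /proj_homogeneous[g1 g2].
  apply: proj_section_eq => x.
    rewrite [LHS](ext_comm (f1 x) (g1 x)); case: (b && c) => //.
  rewrite [LHS](ext_comm (f2 x) (g2 x)); case: (b && c) => //.
Defined.

Section Restriction.
Variables (U V : set (proj_line K)) (VU : V `<=` U).

Fact chart_incl_subproof (c : K -> proj_line K) (x : c @^-1` V) :
  val x \in c @^-1` U.
Proof. by apply/mem_set/VU/set_mem/(valP x). Qed.
Definition chart_incl (c : K -> proj_line K) (x : c @^-1` V) : c @^-1` U :=
  exist _ (val x) (chart_incl_subproof x).

Lemma regular_incl c (f : (c @^-1` U) -> exterior K m) :
  super_regular f -> super_regular (fun x => f (@chart_incl c x)).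
Proof.
move=> hf I a; have [p [q [qa fE]]] := hf I (chart_incl a).
by exists p, q; split=> // x qx; rewrite fE.
Qed.

Fact proj_res_glued (f : proj_section U) :
  glued ((fun z => (proj_val f).1 (chart_incl z),
          fun w => (proj_val f).2 (chart_incl w)) : chart_sections V).
Proof.
have [f1 f2 f12] := proj_sectionP f.
by split; [exact: regular_incl..|] => z w zw;
  exact: (f12 (chart_incl z) (chart_incl w) zw).
Qed.
Definition proj_res (f : proj_superring U) : proj_superring V :=
  mk_section (proj_res_glued f).

Fact proj_res_additive : zmod_morphism proj_res.
Proof. by move=> f g; apply: proj_section_eq. Qed.
HB.instance Definition _ := GRing.isZmodMorphism.Build _ _ proj_res
  proj_res_additive.
Fact proj_res_multiplicative : monoid_morphism proj_res.
Proof. by split=> [|f g]; apply: proj_section_eq. Qed.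
HB.instance Definition _ := GRing.isMonoidMorphism.Build _ _ proj_res
  proj_res_multiplicative.

End Restriction.

Section Gluing.
Variables (U : set (proj_line K)) (I : Type) (V : I -> opens (proj_line K)).
Variables (VU : forall i, V i `<=` U) (cov : U `<=` \bigcup_i V i).

Arguments VU : clear implicits.

Section ChartGluing.
Variables (c : K -> proj_line K) (f : forall i, (c @^-1` V i) -> exterior K m).
Hypothesis fcompat : forall i j (x : c @^-1` V i) (y : c @^-1` V j),
  val x = val y -> f x = f y.

Fact chart_glue_ex (x : c @^-1` U) : exists i, val x \in c @^-1` V i.
Proof.
have /set_mem/cov[i _ Vi] := valP x.
by exists i; apply/mem_set.
Qed.

Definition chart_glue (x : c @^-1` U) : exterior K m :=
  f (exist _ (val x) (projT2 (cid (chart_glue_ex x)))).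

Lemma chart_glueE i (x : c @^-1` V i) : chart_glue (chart_incl (VU i) x) = f x.
Proof. exact: fcompat. Qed.

Lemma chart_glue_regular : (forall i, zariski_open (c @^-1` V i)) ->
  (forall i, super_regular (@f i)) -> super_regular chart_glue.
Proof.
move=> oV hf J a; have [i ai] := chart_glue_ex a.
have [S hS] := oV i; have := set_mem ai; rewrite hS => -[r Sr ra].
have [p [q [qa fE]]] := hf i J (exist _ (val a) ai).
exists (p * r), (q * r); rewrite hornerM mulf_neq0 //; split=> // x.
rewrite hornerM mulf_eq0 negb_or => /andP[qx rx].
have xi : val x \in c @^-1` V i by apply/mem_set; rewrite hS; exists r.
have -> : x = chart_incl (VU i) (exist _ (val x) xi) by apply: val_inj.
by rewrite chart_glueE fE // !hornerM -mulf_div divff // mulr1.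
Qed.

End ChartGluing.

Variable a : forall i, proj_superring (V i).
Hypothesis compat : forall i j (W : opens (proj_line K))
  (Wi : W `<=` V i) (Wj : W `<=` V j), proj_res Wi (a i) = proj_res Wj (a j).

Fact glue_compat i j : exists W : opens (proj_line K),
  oset W = V i `&` V j.
Proof.
by exists (Opens (openI (oset_open (V i)) (oset_open (V j)))).
Qed.

Fact glue_compat_z i j (x : chart_z @^-1` V i) (y : chart_z @^-1` V j) :
  val x = val y -> (proj_val (a i)).1 x = (proj_val (a j)).1 y.
Proof.
move=> xy; have [W WE] := glue_compat i j.
have Wi : W `<=` V i by rewrite WE => ? [].
have Wj : W `<=` V j by rewrite WE => ? [].
have xW : val x \in chart_z @^-1` W.
  apply/mem_set; rewrite /= WE; split; first exact: (set_mem (valP x)).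
  by rewrite xy; exact: (set_mem (valP y)).
have := congr1 (fun g : proj_section W => (proj_val g).1 (exist _ (val x) xW))
  (compat Wi Wj).
rewrite /=; have -> : chart_incl Wi (exist _ (val x) xW) = x by exact: val_inj.
by have -> : chart_incl Wj (exist _ (val x) xW) = y by exact: val_inj.
Qed.

Fact glue_compat_w i j (x : chart_w @^-1` V i) (y : chart_w @^-1` V j) :
  val x = val y -> (proj_val (a i)).2 x = (proj_val (a j)).2 y.
Proof.
move=> xy; have [W WE] := glue_compat i j.
have Wi : W `<=` V i by rewrite WE => ? [].
have Wj : W `<=` V j by rewrite WE => ? [].
have xW : val x \in chart_w @^-1` W.
  apply/mem_set; rewrite /= WE; split; first exact: (set_mem (valP x)).
  by rewrite xy; exact: (set_mem (valP y)).
have := congr1 (fun g : proj_section W => (proj_val g).2 (exist _ (val x) xW))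
  (compat Wi Wj).
rewrite /=; have -> : chart_incl Wi (exist _ (val x) xW) = x by exact: val_inj.
by have -> : chart_incl Wj (exist _ (val x) xW) = y by exact: val_inj.
Qed.

Lemma chart_zwE z w : z * w = 1 :> K -> chart_z z = chart_w w.
Proof.
move=> zw; have w0 : w != 0.
  by apply: contra_eq_neq zw => ->; rewrite mulr0 eq_sym oner_neq0.
rewrite /chart_w /chart_z (negPf w0); congr Some.
by apply: (mulIf w0); rewrite zw mulVf.
Qed.

Fact glue_glued : glued ((chart_glue (fun i => (proj_val (a i)).1),
  chart_glue (fun i => (proj_val (a i)).2)) : chart_sections U).
Proof.
split=> [||z w zw].
- apply: chart_glue_regular; first exact: glue_compat_z.
    by move=> i; have [] := oset_open (V i).
  by move=> i; have [] := proj_sectionP (a i).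
- apply: chart_glue_regular; first exact: glue_compat_w.
    by move=> i; have [] := oset_open (V i).
  by move=> i; have [] := proj_sectionP (a i).
have [i zi] := chart_glue_ex z.
have wi : val w \in chart_w @^-1` V i.
  by apply/mem_set; rewrite /= -(chart_zwE zw); exact: (set_mem zi).
have -> : z = chart_incl (VU i) (exist _ (val z) zi) by exact: val_inj.
have -> : w = chart_incl (VU i) (exist _ (val w) wi) by exact: val_inj.
rewrite /= (chart_glueE glue_compat_z) (chart_glueE glue_compat_w).
have [_ _ h] := proj_sectionP (a i).
exact: (h (exist _ (val z) zi) (exist _ (val w) wi) zw).
Qed.

Lemma proj_glue :
  exists! b : proj_superring U, forall i, proj_res (VU i) b = a i.
Proof.
exists (mk_section glue_glued); split=> [i|b hb].
  apply: proj_section_eq => x.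
    exact: (chart_glueE glue_compat_z).
  exact: (chart_glueE glue_compat_w).
apply: proj_section_eq => x.
  have [i xi] := chart_glue_ex x.
  have -> : x = chart_incl (VU i) (exist _ (val x) xi) by exact: val_inj.
  by rewrite [LHS](chart_glueE glue_compat_z) -hb.
have [i xi] := chart_glue_ex x.
have -> : x = chart_incl (VU i) (exist _ (val x) xi) by exact: val_inj.
by rewrite [LHS](chart_glueE glue_compat_w) -hb.
Qed.

End Gluing.

Definition proj_superspace : superspace.
Proof.
refine (@Superspace (proj_line K) (fun U => proj_superring U)
  (fun U V VU => proj_res VU) _ _ _ _).
- move=> U UU f; apply: proj_section_eq => x /=.
    by congr ((proj_val f).1 _); exact: val_inj.
  by congr ((proj_val f).2 _); exact: val_inj.
- move=> U V W VU WV WU f; apply: proj_section_eq => x /=.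
    by congr ((proj_val f).1 _); exact: val_inj.
  by congr ((proj_val f).2 _); exact: val_inj.
- by move=> U V VU f; apply: proj_section_eq.
- by move=> U I V VU a cov compat; apply: proj_glue.
Defined.

End ProjectiveLine.

(* Main.v *)
Require Import Defs.
From HB Require Import structures.
From mathcomp Require Import all_boot all_order all_algebra.
From mathcomp Require Import boolp classical_sets functions.
From mathcomp Require Import topology reals complex ring.

Set Implicit Arguments.
Unset Strict Implicit.
Unset Printing Implicit Defensive.

Import Order.TTheory GRing.Theory Num.Theory.

Local Open Scope ring_scope.
Local Open Scope classical_set_scope.

(** Let E be a Pi-invertible sheaf. Because Pi (Pi s) = s, E is locally
    generated by an even section e for which e, Pi e is a frame
    (pi_generator_exists), and two such generators are related by
    e' = g e + k Pi e with g even and invertible and k odd. A splitting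
    L + Pi L of E is the choice of a line L, which over an open set carrying a
    generator e is spanned by e + u Pi e for a unique odd function u. Splittings
    are thus described locally by odd functions, and whether they exist globally
    is a question about the cohomology of the odd part of the structure sheaf.
    As theta_i = psi_i / w, a monomial of degree k in the theta_i has
    coefficients in O(-k): the odd part is built from copies of O(-1), O(-3),
    and so on.

    For m <= 2 only O(-1) occurs, products of three odd functions vanish, and
    a change of generator translates u by the odd function k / g. Splittings
    form a torsor under a sum of copies of O(-1), whose first cohomology is
    zero. Explicitly, fix a generator e0 over the complement U0 of finitely many
    points. A generator near one of these points p is proportional to
    e0 + h_p Pi e0 for an odd function h_p, whose coefficients are rational, and
    partial fractions (principal_part) provide an odd function r on U0 such that
    r - h_p is regular near each p (odd_principal_parts). The line spanned by
    e0 + r Pi e0 over U0 then extends to all of P^1 (split_of_shifts), and a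
    line spanned everywhere by local generators splits E
    (split_of_proportional_generators).

    For m > 2 the sheaf O(-3) occurs, and its first cohomology is not zero:
    h = theta_0 theta_1 theta_2 / z is not a difference of functions on the two
    charts (not_pole). Glue the free sheaves on the two charts by
    e2 = e1 + h Pi e1. A splitting would yield odd functions a and b on the
    charts with h + b = (1 - b h) a (glued_split). The product b h a has degree
    at least 5 in the theta_i, so that the coefficients of
    theta_0 theta_1 theta_2 would exhibit h as the difference of a and b
    (residue_not_split). *)

(** * Parity calculus *)

Section Homogeneous.
Variables (V : zmodType) (ev : {additive V -> V}).
Implicit Types (b : bool) (x y : V).

Lemma homogeneous0 b : homogeneous ev b 0.
Proof. by rewrite /homogeneous raddf0; case: b. Qed.

Lemma homogeneousD b x y :
  homogeneous ev b x -> homogeneous ev b y -> homogeneous ev b (x + y).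
Proof.
by rewrite /homogeneous raddfD => -> ->; case: b; rewrite ?addr0.
Qed.

Lemma homogeneousN b x : homogeneous ev b x -> homogeneous ev b (- x).
Proof. by rewrite /homogeneous raddfN => ->; case: b; rewrite ?oppr0. Qed.

Lemma homogeneousB b x y :
  homogeneous ev b x -> homogeneous ev b y -> homogeneous ev b (x - y).
Proof. by move=> hx hy; apply: homogeneousD => //; apply: homogeneousN. Qed.

End Homogeneous.

Notation even_sec := (homogeneous (@sring_ev _) false).
Notation odd_sec := (homogeneous (@sring_ev _) true).
Notation even_vec := (homogeneous (@smod_ev _ _) false).
Notation odd_vec := (homogeneous (@smod_ev _ _) true).

Section Superring.
Variable A : superring.
Implicit Types a b : A.

Lemma parity_split a : a = sring_ev A a + (a - sring_ev A a).
Proof. by rewrite subrKC. Qed.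

Lemma parity_sign0 : parity_sign 0 = 0 :> A.
Proof. by rewrite /parity_sign raddf0 !subr0. Qed.

Lemma parity_signN a : parity_sign (- a) = - parity_sign a.
Proof. by rewrite /parity_sign raddfN !opprD !opprK. Qed.

Lemma parity_sign_ev a :
  sring_ev A (parity_sign a) = parity_sign (sring_ev A a).
Proof. by rewrite /parity_sign !raddfB /= !sring_ev_idem. Qed.

Lemma even_parity_sign a : even_sec a -> parity_sign a = a.
Proof. by move=> /parity_signE ->; rewrite expr0 mul1r. Qed.

Lemma odd_parity_sign a : odd_sec a -> parity_sign a = - a.
Proof. by move=> /parity_signE ->; rewrite expr1 mulN1r. Qed.

Lemma even_commr a b : even_sec a -> a * b = b * a.
Proof.
move=> ha; rewrite (parity_split b) mulrDr mulrDl.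
rewrite (sring_comm ha (homogeneous_ev b)) (sring_comm ha (homogeneous_odd b)).
by rewrite /= expr0 !mul1r.
Qed.

Lemma odd_anticomm a b : odd_sec a -> odd_sec b -> a * b = - (b * a).
Proof.
by move=> ha hb; rewrite (sring_comm ha hb) expr1 mulN1r.
Qed.

Lemma even_mul_even a b : even_sec a -> even_sec b -> even_sec (a * b).
Proof. exact: sring_grading. Qed.

Lemma odd_mul_odd a b : odd_sec a -> odd_sec b -> even_sec (a * b).
Proof. exact: sring_grading. Qed.

Lemma even_mul_odd a b : even_sec a -> odd_sec b -> odd_sec (a * b).
Proof. exact: sring_grading. Qed.

Lemma parity_signK a : parity_sign (parity_sign a) = a.
Proof.
rewrite {2}/parity_sign parity_signD.
rewrite -[X in _ + X]opprK -[X in - X]/(- parity_sign _).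
rewrite (even_parity_sign (homogeneous_ev a)) odd_parity_sign; last first.
  by apply: homogeneousN; apply: homogeneous_odd.
by rewrite opprK opprK subrKC.
Qed.

Variable M : supermodule A.

Lemma smod_evZ_even a (s : M) :
  even_vec s -> smod_ev M (a *: s) = sring_ev A a *: s.
Proof.
move=> hs; rewrite {1}(parity_split a) scalerDl raddfD /=.
have := smod_grading (homogeneous_ev a) hs; rewrite /homogeneous /= => ->.
have := smod_grading (homogeneous_odd a) hs; rewrite /homogeneous /= => ->.
by rewrite addr0.
Qed.

Lemma smod_evZ_odd a (s : M) :
  odd_vec s -> smod_ev M (a *: s) = (a - sring_ev A a) *: s.
Proof.
move=> hs; rewrite {1}(parity_split a) scalerDl raddfD /=.
have := smod_grading (homogeneous_ev a) hs; rewrite /homogeneous /= => ->.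
have := smod_grading (homogeneous_odd a) hs; rewrite /homogeneous /= => ->.
by rewrite add0r.
Qed.

Lemma sring_evM_odd a b : odd_sec b ->
  sring_ev A (a * b) = (a - sring_ev A a) * b.
Proof.
move=> hb; rewrite {1}(parity_split a) mulrDl raddfD /=.
have := sring_grading (homogeneous_ev a) hb; rewrite /homogeneous /= => ->.
have := sring_grading (homogeneous_odd a) hb; rewrite /homogeneous /= => ->.
by rewrite add0r.
Qed.

End Superring.

Definition odd_squares_vanish (X : superspace) : Prop :=
  forall (U : opens X) (a : osec U), odd_sec a -> a * a = 0.

Section Restriction.
Variables (X : superspace) (U V : opens X) (VU : V `<=` U).

Lemma homogeneous_res b (a : osec U) :
  homogeneous (@sring_ev _) b a -> homogeneous (@sring_ev _) b (ores VU a).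
Proof.
by rewrite /homogeneous ores_ev => ->; case: b => //; rewrite rmorph0.
Qed.

Lemma homogeneous_mres (F : module_sheaf X) b (s : F U) :
  homogeneous (@smod_ev _ _) b s -> homogeneous (@smod_ev _ _) b (mres VU s).
Proof.
by rewrite /homogeneous mres_ev => ->; case: b => //; rewrite raddf0.
Qed.

Lemma pisym_scaleE (F : module_sheaf X) (P : pi_symmetry F) (a : osec U)
  (s : F U) : P U (a *: s) = parity_sign a *: P U s.
Proof.
rewrite {1}(parity_split a) scalerDl raddfD /=.
rewrite (pisym_scale P s (homogeneous_ev a)).
rewrite (pisym_scale P s (homogeneous_odd a)).
by rewrite expr0 mul1r expr1 mulN1r -scalerDl.
Qed.

Lemma pisym_ev (F : module_sheaf X) (P : pi_symmetry F) (s : F U) :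
  smod_ev (F U) (P U s) = P U (s - smod_ev (F U) s).
Proof.
have he : even_vec (smod_ev (F U) s) by exact: smod_ev_idem.
have ho : odd_vec (s - smod_ev (F U) s).
  by rewrite /homogeneous raddfB smod_ev_idem subrr.
rewrite -{1}(subrKC (smod_ev (F U) s) s) (raddfD (P U)) (raddfD (smod_ev (F
  U))).
have := pisym_odd P he; rewrite /homogeneous /= => ->.
have := pisym_odd P ho; rewrite /homogeneous /= => ->.
by rewrite add0r.
Qed.

End Restriction.

(** * Sheaves determined by their local sections *)

Section Opens.
Variable X : topologicalType.

Definition opens_meet (U V : opens X) : opens X :=
  Opens (openI (oset_open U) (oset_open V)).

Lemma opens_meetl (U V : opens X) : opens_meet U V `<=` U.
Proof. by move=> x []. Qed.
Lemma opens_meetr (U V : opens X) : opens_meet U V `<=` V.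
Proof. by move=> x []. Qed.

Lemma opens_meet_max (U V W : opens X) :
  W `<=` U -> W `<=` V -> W `<=` opens_meet U V.
Proof. by move=> WU WV x Wx; split; [exact: WU|exact: WV]. Qed.

Lemma opens_meetS (U V U' V' : opens X) :
  U `<=` U' -> V `<=` V' -> opens_meet U V `<=` opens_meet U' V'.
Proof. by move=> UU VV x [/UU ? /VV ?]; split. Qed.

End Opens.

Section StructureSheaf.
Variable X : superspace.

Definition regular_module (A : superring) : supermodule A :=
  @SuperModule A (A : pzRingType)^o (sring_ev A) (@sring_ev_idem A)
    (@sring_grading A).

(** The structure sheaf as a module, so that the gluing lemmas for module
    sheaves apply to functions. *)
Definition structure_sheaf : module_sheaf X :=
  @ModuleSheaf X (fun U => regular_module (osec U))
    (fun U V VU => ores VU) (fun U V VU => rmorphM (ores VU))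
    (@ores_id X) (@ores_comp X) (@ores_ev X) (@osec_glue X).

Variables (F : module_sheaf X) (U : opens X).

(** A sheaf is separated, so that equalities of sections are local. *)
Lemma mres_inj_local (s t : F U) :
  (forall x, oset U x -> exists V : opens X, oset V x /\
     exists VU : V `<=` U, mres VU s = mres VU t) -> s = t.
Proof.
move=> h.
pose I := {x | oset U x}.
pose V (i : I) := projT1 (cid (h _ (projT2 i))).
have Vx (i : I) : oset (V i) (projT1 i).
  by case: (projT2 (cid (h _ (projT2 i)))).
have hV (i : I) : exists VU : V i `<=` U, mres VU s = mres VU t.
  by case: (projT2 (cid (h _ (projT2 i)))).
pose VU i := projT1 (cid (hV i)).
have st i : mres (VU i) s = mres (VU i) t := projT2 (cid (hV i)).
have cov : U `<=` \bigcup_i V i.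
  by move=> x Ux; exists (exist _ x Ux) => //; exact: Vx (exist _ x Ux).
have [|b [_ ub]] := msec_glue VU (s := fun i => mres (VU i) s) cov.
  by move=> i j W Wi Wj; rewrite !(mres_comp _ _ (subset_trans Wi (VU i))).
by rewrite -(ub s) // -(ub t).
Qed.

(** Uniqueness makes the local sections agree on overlaps. *)
Lemma glue_unique (P : forall V : opens X, F V -> Prop) :
  (forall (V W : opens X) (WV : W `<=` V) s, P V s -> P W (mres WV s)) ->
  (forall (V : opens X) s t, V `<=` U -> P V s -> P V t -> s = t) ->
  (forall x, oset U x -> exists V : opens X, [/\ oset V x, V `<=` U
     & exists s, P V s]) ->
  exists t : F U, forall x, oset U x -> exists V : opens X, oset V x /\
     exists VU : V `<=` U, P V (mres VU t).
Proof.
move=> Pres Puniq h.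
pose I := {x | oset U x}.
pose V (i : I) := projT1 (cid (h _ (projT2 i))).
have hV (i : I) : [/\ oset (V i) (projT1 i), V i `<=` U & exists s, P (V i) s].
  exact: projT2 (cid (h _ (projT2 i))).
have VU i : V i `<=` U by case: (hV i).
have Ps i : exists s, P (V i) s by case: (hV i).
pose s i := projT1 (cid (Ps i)).
have sP i : P (V i) (s i) := projT2 (cid (Ps i)).
have cov : U `<=` \bigcup_i V i.
  by move=> x Ux; exists (exist _ x Ux) => //; case: (hV (exist _ x Ux)).
have [|t [tE _]] := msec_glue VU (s := s) cov.
  move=> i j W Wi Wj; apply: Puniq; try exact: Pres.
  exact: subset_trans Wi (VU i).
exists t => x Ux; pose i : I := exist _ x Ux.
by exists (V i); split; [case: (hV i)|exists (VU i); rewrite tE].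
Qed.

End StructureSheaf.

Section Subsheaf.
Variables (X : superspace) (F : module_sheaf X).
Variable P : forall U : opens X, F U -> Prop.
Hypotheses (P0 : forall U, P (0 : F U))
  (PD : forall U (s t : F U), P s -> P t -> P (s + t))
  (PZ : forall U (a : osec U) (s : F U), P s -> P (a *: s))
  (Pev : forall U (s : F U), P s -> P (smod_ev (F U) s))
  (Pres : forall (U V : opens X) (VU : V `<=` U) (s : F U),
     P s -> P (mres VU s))
  (Ploc : forall (U : opens X) (s : F U),
     (forall x, oset U x -> exists V : opens X, oset V x /\
        exists VU : V `<=` U, P (mres VU s)) -> P s).

Definition subsheaf_pred (U : opens X) : {pred F U} := fun s => `[< P s >].

Fact subsheaf_closed (U : opens X) : subsemimod_closed (@subsheaf_pred U).
Proof.
split; first split; first exact/asboolP/P0.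
- by move=> s t /asboolP hs /asboolP ht; apply/asboolP/PD.
- by move=> c s /asboolP hs; apply/asboolP/PZ.
Qed.

Record subsheaf_section (U : opens X) := SubsheafSection {
  subsheaf_val :> F U;
  _ : subsheaf_val \in @subsheaf_pred U
}.

HB.instance Definition _ U := [isSub for @subsheaf_val U].
HB.instance Definition _ U := [Choice of subsheaf_section U by <:].
HB.instance Definition _ U := GRing.SubChoice_isSubLmodule.Build
  (osec U) (F U) (@subsheaf_pred U) (subsheaf_section U) (@subsheaf_closed U).

Definition mk_subsheaf (U : opens X) (s : F U) (hs : P s) :
  subsheaf_section U := SubsheafSection (introT (asboolP _) hs).

Lemma subsheafP (U : opens X) (s : subsheaf_section U) : P (val s).
Proof. by apply/asboolP; case: s. Qed.

Definition subsheaf_ev (U : opens X) (s : subsheaf_section U) :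
  subsheaf_section U := mk_subsheaf (Pev (subsheafP s)).

Fact subsheaf_ev_additive U : zmod_morphism (@subsheaf_ev U).
Proof. by move=> s t; apply: val_inj; exact: (raddfB (smod_ev (F U))). Qed.
HB.instance Definition _ U := GRing.isZmodMorphism.Build _ _ (@subsheaf_ev U)
  (@subsheaf_ev_additive U).

Fact subsheaf_ev_idem U (s : subsheaf_section U) :
  subsheaf_ev (subsheaf_ev s) = subsheaf_ev s.
Proof. by apply: val_inj; exact: smod_ev_idem. Qed.

Lemma subsheaf_homogeneous U b (s : subsheaf_section U) :
  homogeneous (@subsheaf_ev U) b s <-> homogeneous (@smod_ev _ _) b (val s).
Proof.
split=> [/(congr1 val)|h]; first by case: b.
by apply: val_inj; rewrite [LHS]h; case: b {h}.
Qed.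

Fact subsheaf_grading U b c (a : osec U) (s : subsheaf_section U) :
  homogeneous (@sring_ev _) b a -> homogeneous (@subsheaf_ev U) c s ->
  homogeneous (@subsheaf_ev U) (b (+) c) (a *: s).
Proof.
move=> ha /subsheaf_homogeneous hs; apply/subsheaf_homogeneous.
exact: (smod_grading ha hs).
Qed.

Definition subsheaf_module U : supermodule (osec U) :=
  @SuperModule (osec U) (subsheaf_section U) (@subsheaf_ev U)
    (@subsheaf_ev_idem U) (@subsheaf_grading U).

Definition subsheaf_res (U V : opens X) (VU : V `<=` U)
  (s : subsheaf_section U) : subsheaf_section V :=
  mk_subsheaf (Pres VU (subsheafP s)).

Fact subsheaf_res_additive (U V : opens X) (VU : V `<=` U) :
  zmod_morphism (subsheaf_res VU).
Proof. by move=> s t; apply: val_inj; exact: (raddfB (mres VU)). Qed.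
HB.instance Definition _ U V (VU : oset V `<=` oset U) :=
  GRing.isZmodMorphism.Build _ _ (subsheaf_res VU) (subsheaf_res_additive VU).

Definition subsheaf : module_sheaf X.
Proof.
refine (@ModuleSheaf X subsheaf_module (fun U V VU => @subsheaf_res U V VU)
  _ _ _ _ _).
- by move=> U V VU a s; apply: val_inj; exact: mres_scale.
- by move=> U UU s; apply: val_inj; exact: mres_id.
- by move=> U V W VU WV WU s; apply: val_inj; exact: mres_comp.
- by move=> U V VU s; apply: val_inj; exact: mres_ev.
- move=> U I V VU s cov compat.
  have [|t [tE ut]] := msec_glue VU (s := fun i => val (s i)) cov.
    by move=> i j W Wi Wj; exact: (congr1 val (compat i j W Wi Wj)).
  have ht : P t.
    apply: Ploc => x /cov[i _ Vx]; exists (V i); split=> //.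
    by exists (VU i); rewrite tE; exact: subsheafP.
  exists (mk_subsheaf ht); split=> [i|t' ht']; apply: val_inj => /=.
    exact: tE.
  by apply: ut => i; rewrite -ht'.
Defined.

Variables (PF : pi_symmetry F).
Hypothesis Ppi : forall U (s : F U), P s -> P (PF U s).

Definition subsheaf_pi (U : opens X) (s : subsheaf U) : subsheaf U :=
  mk_subsheaf (Ppi (subsheafP s)).

Fact subsheaf_pi_additive U : zmod_morphism (@subsheaf_pi U).
Proof. by move=> s t; apply: val_inj; exact: (raddfB (PF U)). Qed.
HB.instance Definition _ U := GRing.isZmodMorphism.Build _ _
  (@subsheaf_pi U) (@subsheaf_pi_additive U).

Definition subsheaf_symmetry : pi_symmetry subsheaf.
Proof.
refine (@PiSymmetry X subsheaf (fun U => @subsheaf_pi U) _ _ _ _).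
- by move=> U V VU s; apply: val_inj; exact: pisym_res.
- move=> U b s /subsheaf_homogeneous hs; apply/subsheaf_homogeneous.
  exact: pisym_odd.
- by move=> U b a s ha; apply: val_inj; exact: pisym_scale.
- by move=> U s; apply: val_inj; exact: pisym_invol.
Defined.

End Subsheaf.

(** * Generators adapted to a parity-exchanging symmetry *)

Section Generators.
Variables (X : superspace) (E : module_sheaf X) (PE : pi_symmetry E).

Definition comb (U : opens X) (e : E U) (a b : osec U) : E U :=
  a *: e + b *: PE U e.

Section Combinations.
Variable U : opens X.
Implicit Types (e : E U) (a b c d g k : osec U).

Lemma comb_r0 e a : comb e a 0 = a *: e.
Proof. by rewrite /comb scale0r addr0. Qed.

Lemma comb10 e : comb e 1 0 = e.
Proof. by rewrite comb_r0 scale1r. Qed.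

Lemma combD e a b c d : comb e a b + comb e c d = comb e (a + c) (b + d).
Proof. by rewrite /comb addrACA -!scalerDl. Qed.

Lemma combB e a b c d : comb e a b - comb e c d = comb e (a - c) (b - d).
Proof. by rewrite /comb opprD addrACA -!scalerBl. Qed.

Lemma combZ e c a b : c *: comb e a b = comb e (c * a) (c * b).
Proof. by rewrite /comb scalerDr !scalerA. Qed.

Lemma pisym_comb e a b :
  PE U (comb e a b) = comb e (parity_sign b) (parity_sign a).
Proof. by rewrite /comb raddfD /= !pisym_scaleE pisym_invol addrC. Qed.

(** Over the complex numbers, (g, k) |-> g + i k turns this rule, for even g, a
    and odd k, b, into the multiplication of the structure sheaf; changes of
    generators are thus its invertible sections. *)
Lemma comb_comb e g k a b : comb (comb e g k) a b =
  comb e (a * g + b * parity_sign k) (a * k + b * parity_sign g).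
Proof. by rewrite {1}/comb pisym_comb !combZ combD. Qed.

Lemma comb_ev e a b : even_vec e ->
  smod_ev (E U) (comb e a b) = comb e (sring_ev _ a) (b - sring_ev _ b).
Proof.
move=> ee; rewrite /comb raddfD /= (smod_evZ_even _ ee) smod_evZ_odd //.
exact: (pisym_odd PE ee).
Qed.

End Combinations.

Lemma mres_comb (U V : opens X) (VU : V `<=` U) (e : E U) a b :
  mres VU (comb e a b) = comb (mres VU e) (ores VU a) (ores VU b).
Proof. by rewrite raddfD /= !mres_scale -pisym_res. Qed.

(** A frame of rank 1|1 adapted to Pi, which amounts to a local isomorphism with
    the free sheaf with its standard symmetry. *)
Definition pi_generator (U : opens X) (e : E U) : Prop :=
  [/\ even_vec e,
      forall (V : opens X) (VU : V `<=` U) (s : E V), exists a b,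
        s = comb (mres VU e) a b
    & forall (V : opens X) (VU : V `<=` U) a b,
        comb (mres VU e) a b = 0 -> a = 0 /\ b = 0].

Lemma pi_generator_res (U V : opens X) (VU : V `<=` U) (e : E U) :
  pi_generator e -> pi_generator (mres VU e).
Proof.
move=> [ee gen free]; split; first exact: homogeneous_mres.
  by move=> W WV s; rewrite (mres_comp _ _ (subset_trans WV VU)).
by move=> W WV a b; rewrite (mres_comp _ _ (subset_trans WV VU)); apply: free.
Qed.

Section OneGenerator.
Variables (U : opens X) (e : E U).
Hypothesis ge : pi_generator e.

Lemma pi_generator_gen (s : E U) : exists a b, s = comb e a b.
Proof.
by case: ge => _ gen _; have := gen U (@subset_refl _ _) s; rewrite mres_id.
Qed.

Lemma pi_generator_inj (a b c d : osec U) :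
  comb e a b = comb e c d -> a = c /\ b = d.
Proof.
case: ge => _ _ free h.
have := free U (@subset_refl _ _) (a - c) (b - d).
by rewrite mres_id -combB h subrr => /(_ erefl)[/subr0_eq -> /subr0_eq ->].
Qed.

Lemma pi_generator_even (a b : osec U) :
  even_vec (comb e a b) -> even_sec a /\ odd_sec b.
Proof.
case: (ge) => ee _ _;
  rewrite /homogeneous comb_ev // => /pi_generator_inj[-> h].
by split=> //; have := congr1 (fun x => b - x) h; rewrite subKr subrr.
Qed.

End OneGenerator.

Hypothesis sq0 : odd_squares_vanish X.

(** In a homogeneous frame e, f write Pi e = a e + b f and Pi f = c e + d f.
    The coefficient of e in Pi (Pi e) = e gives b c = 1, as a is odd and thus of
    square zero; f can therefore be replaced by Pi e. *)
Lemma pi_generator_exists : locally_free 1 1 E ->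
  forall x : X, exists U : opens X, oset U x /\ exists e : E U, pi_generator e.
Proof.
move=> lf x; have [U [Ux [e [f [/(_ ord0) ee /(_ ord0) fo fr]]]]] := lf x.
exists U; split=> //; exists (e ord0).
pose cc (V : opens X) (VU : V `<=` U) a b :=
  a *: mres VU (e ord0) + b *: mres VU (f ord0).
have gen V VU (s : E V) : exists a b, s = cc V VU a b.
  have [c [-> _]] := fr V VU s; exists (c.1 ord0), (c.2 ord0).
  by rewrite !big_ord1.
have inj V VU a b c d : cc V VU a b = cc V VU c d -> a = c /\ b = d.
  move=> h; have [k [_ uk]] := fr V VU (cc V VU a b).
  have := uk (fun=> a, fun=> b); rewrite !big_ord1 => /(_ erefl) kE.
  have := uk (fun=> c, fun=> d); rewrite !big_ord1 -/(cc V VU c d) => /(_ h).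
  by rewrite kE => -[/(congr1 (@^~ ord0)) -> /(congr1 (@^~ ord0)) ->].
have ccD V VU a b c d : cc V VU a b + cc V VU c d = cc V VU (a + c) (b + d).
  by rewrite /cc addrACA -!scalerDl.
have ccZ V VU c a b : c *: cc V VU a b = cc V VU (c * a) (c * b).
  by rewrite /cc scalerDr !scalerA.
have ccev V VU a b : smod_ev (E V) (cc V VU a b) =
    cc V VU (sring_ev _ a) (b - sring_ev _ b).
  have /smod_evZ_even he := homogeneous_mres VU ee.
  have /smod_evZ_odd hf := homogeneous_mres VU fo.
  by rewrite raddfD /= he hf.
pose UU := @subset_refl _ (oset U).
have [a [b Pe]] := gen U UU (PE U (e ord0)).
have [c [d Pf]] := gen U UU (PE U (f ord0)).
have cc0 V VU : cc V VU 0 0 = 0 by rewrite /cc !scale0r addr0.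
have [ha hb] : odd_sec a /\ even_sec b.
  have := pisym_odd PE ee; rewrite /homogeneous Pe ccev /= -(cc0 U UU).
  move=> /inj[-> /subr0_eq hb]; split=> //.
have hc : even_sec c.
  by have := pisym_odd PE fo; rewrite /homogeneous Pf ccev /= => /inj[-> _].
have bc : b * c = 1.
  have := congr1 (PE U) Pe;
    rewrite pisym_invol raddfD /= !pisym_scaleE !mres_id.
  rewrite Pe Pf !ccZ ccD odd_parity_sign // mulNr (sq0 ha) oppr0 add0r.
  rewrite even_parity_sign //.
  have -> : e ord0 = cc U UU 1 0 by rewrite /cc scale1r scale0r addr0 mres_id.
  by move=> /inj[<- _].
have cb : c * b = 1 by rewrite even_commr.
have PeV (V : opens X) (VU : V `<=` U) :
    PE V (mres VU (e ord0)) = cc V VU (ores VU a) (ores VU b).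
  rewrite pisym_res Pe /cc raddfD /= !mres_scale.
  by rewrite !(mres_comp _ _ VU).
have combE (V : opens X) (VU : V `<=` U) k l : comb (mres VU (e ord0)) k l =
    cc V VU (k + l * ores VU a) (l * ores VU b).
  by rewrite /comb PeV ccZ -[RHS]addr0 -[in RHS](scale0r (mres VU (f ord0)))
    /cc addrA -scalerDl scale0r addr0.
split=> // V VU.
  move=> s; have [k [l ->]] := gen V VU s.
  exists (k - l * ores VU c * ores VU a), (l * ores VU c).
  by rewrite combE subrK -mulrA -rmorphM cb rmorph1 mulr1.
move=> k l; rewrite combE -(cc0 V VU) => /inj[kE lb].
have l0 : l = 0.
  by rewrite -[l]mulr1 -(rmorph1 (ores VU)) -bc rmorphM mulrA lb mul0r.
by move: kE; rewrite l0 mul0r addr0.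
Qed.

(** With e' = e + u Pi e one has e = e' - u Pi e', because u is of square
    zero. *)
Lemma pi_generator_shift (U : opens X) (e : E U) (u : osec U) :
  odd_sec u -> pi_generator e -> pi_generator (comb e 1 u).
Proof.
move=> hu ge; case: (ge) => ee gen free.
have uu V VU : ores VU u * ores VU u = 0 :> osec V.
  by apply: sq0; apply: homogeneous_res.
have su V VU : parity_sign (ores VU u) = - ores VU u :> osec V.
  by apply: odd_parity_sign; apply: homogeneous_res.
split.
- have := comb_ev 1 u ee; rewrite (sring_1even (osec U)) hu subr0.
  exact.
- move=> V VU s; have [a [b ->]] := gen V VU s.
  exists (a + b * ores VU u), (b - a * ores VU u).
  rewrite mres_comb rmorph1 comb_comb parity_sign1 su !mulr1 !mulrN.
  rewrite mulrBl mulrDl -!mulrA uu !mulr0 subr0 addr0.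
  by rewrite addrK subrKC.
move=> V VU a b; rewrite mres_comb rmorph1 comb_comb parity_sign1 su !mulr1.
move=> /(free V)[h1 h2]; have aE : a = b * ores VU u.
  by apply/eqP; rewrite -subr_eq0 -mulrN h1.
have b0 : b = 0 by rewrite -h2 aE -mulrA uu mulr0 add0r.
by rewrite aE b0 mul0r.
Qed.

(** If conversely e = a e' + b Pi e', then a g = 1 + b k; the term b k is of
    square zero, so that g is invertible. *)
Lemma pi_generator_change (U : opens X) (e e' : E U) :
  pi_generator e -> pi_generator e' ->
  exists g k g' : osec U, [/\ e' = comb e g k, even_sec g, odd_sec k,
    even_sec g' & g' * g = 1].
Proof.
move=> ge ge'; have [g [k e'E]] := pi_generator_gen ge e'.
have [a [b eE]] := pi_generator_gen ge' e.
have [hg hk] : even_sec g /\ odd_sec k.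
  by apply: (pi_generator_even ge); rewrite -e'E; case: ge'.
have [ha hb] : even_sec a /\ odd_sec b.
  by apply: (pi_generator_even ge'); rewrite -eE; case: ge.
move: (eE); rewrite e'E comb_comb -[LHS]comb10 => /(pi_generator_inj ge)[h _].
rewrite (odd_parity_sign hk) mulrN in h.
have bk2 : b * k * (b * k) = 0.
  by rewrite mulrA -(mulrA b k b) (odd_anticomm hk hb) mulrN mulrA (sq0 hb)
    mul0r oppr0 mul0r.
have agE : a * g = 1 + b * k by rewrite h subrK.
have hbk : even_sec (b * k) by apply: odd_mul_odd.
exists g, k, ((1 - b * k) * a); split=> //.
  by apply: even_mul_even => //; apply: homogeneousB => //; exact: sring_1even.
by rewrite -mulrA agE mulrDr mulr1 mulrBl mul1r bk2 subr0 subrK.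
Qed.

End Generators.

(** * Splittings from proportional generators *)

Section SheafMorphisms.
Variables (X : superspace) (F G : module_sheaf X).

Section LocallyBijective.
Variable psi : forall U : opens X, {additive F U -> G U}.
Hypothesis psi_res : forall (U V : opens X) (VU : V `<=` U) s,
  psi V (mres VU s) = mres VU (psi U s).

(** A morphism of sheaves which is bijective over all small open sets is
    bijective over every open set: injectivity is local, and the local
    preimages glue because they are unique. *)
Lemma sheaf_bijective :
  (forall x : X, exists U : opens X, oset U x /\
     forall V : opens X, V `<=` U ->
       (forall t, exists s, psi V s = t) /\ (forall s, psi V s = 0 -> s = 0)) ->
  forall U, bijective (psi U).
Proof.
move=> loc.
have inj U : injective (psi U).
  move=> s t st; apply: mres_inj_local => x Ux.
  have [V [Vx /(_ (opens_meet U V) (@opens_meetr _ _ _))[_ h]]] := loc x.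
  exists (opens_meet U V); split=> //; exists (@opens_meetl _ _ _).
  by apply: subr0_eq; apply: h; rewrite raddfB !psi_res st subrr.
have surj U t : exists s, psi U s = t.
  pose P (V : opens X) (s : F V) := exists VU : V `<=` U, psi V s = mres VU t.
  have [V W WV s [VU e]|V s s' _ [VU e] [VU' e']|x Ux|s hs] := @glue_unique X
    F U P.
  - exists (subset_trans WV VU).
    by rewrite psi_res e (mres_comp _ _ (subset_trans WV VU)).
  - by apply: inj; rewrite e e' (Prop_irrelevance VU VU').
  - have [V [Vx /(_ (opens_meet U V) (@opens_meetr _ _ _))[h _]]] := loc x.
    have [s hs] := h (mres (@opens_meetl _ U V) t).
    exists (opens_meet U V); split=> //; first exact: opens_meetl.
    by exists s, (@opens_meetl _ _ _).
  exists s; apply: mres_inj_local => x /hs[V [Vx [VU [VU' e]]]].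
  by exists V; split=> //; exists VU;
    rewrite -psi_res e (Prop_irrelevance VU VU').
move=> U; pose g t := projT1 (cid (surj U t)).
have gK t : psi U (g t) = t := projT2 (cid (surj U t)).
by exists g => // s; apply: inj; rewrite gK.
Qed.

End LocallyBijective.

Lemma pi_isomorphic_of_bijection (PF : pi_symmetry F) (PG : pi_symmetry G)
    (psi : forall U : opens X, {linear F U -> G U}) :
  (forall U, bijective (psi U)) ->
  (forall (U V : opens X) (VU : V `<=` U) s,
     psi V (mres VU s) = mres VU (psi U s)) ->
  (forall U s, smod_ev (G U) (psi U s) = psi U (smod_ev (F U) s)) ->
  (forall U s, psi U (PF U s) = PG U (psi U s)) ->
  pi_isomorphic PG PF.
Proof.
move=> bij psi_res psi_ev psi_pi.
have inv U : exists g : G U -> F U, cancel (psi U) g /\ cancel g (psi U).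
  by case: (bij U) => g; exists g.
pose g U := projT1 (cid (inv U)).
have psiK U : cancel (psi U) (g U) by case: (projT2 (cid (inv U))).
have gK U : cancel (g U) (psi U) by case: (projT2 (cid (inv U))).
have glin U : linear (g U).
  by move=> a s t; apply: (can_inj (psiK U)); rewrite linearP !gK.
pose gl U : {linear G U -> F U} :=
  HB.pack (g U) (GRing.isLinear.Build _ _ _ _ (g U) (glin U)).
have glK U : cancel (gl U) (psi U) := gK U.
exists gl; split=> [U|U V VU s|U s|U s].
- by exists (psi U); [exact: glK|exact: psiK].
- by apply: (can_inj (psiK V)); rewrite psi_res !glK.
- by apply: (can_inj (psiK U)); rewrite -psi_ev !glK.
- by apply: (can_inj (psiK U)); rewrite psi_pi !glK.
Qed.

End SheafMorphisms.

Section Splitting.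
Variables (X : superspace) (E : module_sheaf X) (PE : pi_symmetry E).
Variables (U0 : opens X) (e0 : E U0).

(** The condition only looks at U0. Sections over sets that leave U0 are
    controlled by density, so that the line extends across the complement. *)
Definition in_line (U : opens X) (s : E U) : Prop :=
  exists a, mres (@opens_meetl _ U U0) s = a *: mres (@opens_meetr _ U U0) e0.

Fact in_line0 (U : opens X) : in_line (0 : E U).
Proof. by exists 0; rewrite raddf0 scale0r. Qed.

Fact in_lineD (U : opens X) (s t : E U) :
  in_line s -> in_line t -> in_line (s + t).
Proof.
by move=> [a hs] [b ht]; exists (a + b); rewrite raddfD /= hs ht scalerDl.
Qed.

Fact in_lineZ (U : opens X) (c : osec U) (s : E U) :
  in_line s -> in_line (c *: s).
Proof.
move=> [a hs]; exists (ores (@opens_meetl _ U U0) c * a).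
by rewrite mres_scale hs scalerA.
Qed.

Hypothesis ge0 : pi_generator PE e0.

Fact in_line_ev (U : opens X) (s : E U) :
  in_line s -> in_line (smod_ev (E U) s).
Proof.
move=> [a h]; exists (sring_ev _ a); rewrite -mres_ev h smod_evZ_even //.
by apply: homogeneous_mres; case: ge0.
Qed.

Lemma in_line_res (U V : opens X) (VU : V `<=` U) (s : E U) :
  in_line s -> in_line (mres VU s).
Proof.
move=> [a h]; have VUU0 := opens_meetS VU (@subset_refl _ U0).
exists (ores VUU0 a);
  rewrite (mres_comp _ _ (subset_trans (@opens_meetl _ V U0) VU)).
rewrite -(mres_comp (@opens_meetl _ U U0) VUU0) h mres_scale.
by rewrite (mres_comp _ _ (@opens_meetr _ V U0)).
Qed.

(** The Pi e0-coordinate of s over U0 vanishes locally, hence vanishes. *)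
Lemma in_line_local (U : opens X) (s : E U) :
  (forall x, oset U x -> exists V : opens X, oset V x /\
     exists VU : V `<=` U, in_line (mres VU s)) -> in_line s.
Proof.
move=> loc.
have [a [b sE]] := pi_generator_gen (pi_generator_res (@opens_meetr _ U U0) ge0)
  (mres (@opens_meetl _ U U0) s).
exists a; rewrite sE /comb; suff -> : b = 0 by rewrite scale0r addr0.
apply: (@mres_inj_local X (structure_sheaf X)) => x [/loc[V [Vx [VU [c h]]]]
  U0x].
have WU := opens_meetS VU (@subset_refl _ U0).
exists (opens_meet V U0); split=> //; exists WU; rewrite raddf0.
have := congr1 (mres WU) sE; rewrite mres_comb.
rewrite (mres_comp _ _ (subset_trans (@opens_meetl _ V U0) VU)).
rewrite -(mres_comp VU (@opens_meetl _ V U0)) h (mres_comp _ _ (@opens_meetr _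
  V U0)).
rewrite -(comb_r0 PE).
move=> /(pi_generator_inj (pi_generator_res (@opens_meetr _ V U0) ge0))[_ b0].
exact: esym b0.
Qed.

Definition line_sheaf : module_sheaf X :=
  subsheaf in_line0 in_lineD in_lineZ in_line_ev in_line_res in_line_local.

Definition mk_line (U : opens X) (s : E U) (hs : in_line s) : line_sheaf U :=
  mk_subsheaf hs.

Hypothesis dense : forall (U : opens X) (f : osec U),
  ores (@opens_meetl _ U U0) f = 0 -> f = 0.

Hypothesis local_generators : forall x : X, exists U : opens X, oset U x /\
  exists2 e : E U, pi_generator PE e & exists2 c, even_sec c &
    mres (@opens_meetl _ U U0) e = c *: mres (@opens_meetr _ U U0) e0.

Hypothesis sq0 : odd_squares_vanish X.

(** A multiple b Pi e lies in the line only if b c vanishes over U0, where c is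
    invertible; by density b is then zero. *)
Lemma line_frame (x : X) : exists U : opens X, oset U x /\
  exists2 e : E U, pi_generator PE e &
    forall (V : opens X) (VU : V `<=` U) a b,
      in_line (comb PE (mres VU e) a b) <-> b = 0.
Proof.
have [U [Ux [e ge [c hc ec]]]] := local_generators x.
exists U; split=> //; exists e => // V VU a b.
have gU := pi_generator_res (@opens_meetl _ U U0) ge.
have gU0 := pi_generator_res (@opens_meetr _ U U0) ge0.
have [c' [cc' c'c]] : exists c', [/\ c * c' = 1 & even_sec c'].
  have [g [k [g' [eg hg hk hg' g'g]]]] := pi_generator_change sq0 gU0 gU.
  exists g'; split=> //; suff -> : c = g by rewrite even_commr.
  move: eg; rewrite ec -(comb_r0 PE).
  by move=> /(pi_generator_inj gU0)[].
have VUU0 := opens_meetS VU (@subset_refl _ U0).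
have eV : mres (subset_trans (@opens_meetl _ V U0) VU) e =
    comb PE (mres (@opens_meetr _ V U0) e0) (ores VUU0 c) 0.
  rewrite -(mres_comp (@opens_meetl _ U U0) VUU0) ec mres_scale.
  by rewrite (mres_comp _ _ (@opens_meetr _ V U0)) comb_r0.
have hcV := even_parity_sign (homogeneous_res VUU0 hc).
rewrite /in_line mres_comb (mres_comp _ _ (subset_trans (@opens_meetl _ V U0)
  VU)).
rewrite eV comb_comb parity_sign0 !mulr0 addr0 add0r hcV; split=> [[d]|->].
  rewrite -(comb_r0 PE) => /(pi_generator_inj (pi_generator_res (@opens_meetr
    _ V U0) ge0))[_ bc].
  apply: dense; rewrite -[LHS]mulr1 -(rmorph1 (ores VUU0)) -cc' rmorphM mulrA.
  by rewrite bc mul0r.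
by exists (ores (@opens_meetl _ V U0) a * ores VUU0 c);
  rewrite rmorph0 mul0r comb_r0.
Qed.

Lemma line_locally_free : locally_free 1 0 line_sheaf.
Proof.
move=> x; have [U [Ux [e ge frame]]] := line_frame x.
have le : in_line e.
  by have := (frame U (@subset_refl _ _) 1 0).2 erefl; rewrite comb10 mres_id.
exists U; split=> //; exists (fun=> mk_line le), (fun=> 0); split=> [_|[] //|].
  by apply/subsheaf_homogeneous; case: ge.
move=> V VU s; have /= [a [b sE]] := ((let: And3 _ g _ := ge in g) V VU (val
  s)).
have b0 : b = 0 by apply/(frame V VU a); rewrite -sE; exact: subsheafP.
exists (fun=> a, fun=> 0); split.
  apply: val_inj; rewrite big_ord1 big_ord0 addr0 /= sE b0.
  exact: comb_r0.
move=> [c d]; rewrite big_ord1 big_ord0 addr0 => /(congr1 val).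
rewrite /= sE b0 -[RHS](comb_r0 PE (mres VU e)) => h.
have [aE _] := pi_generator_inj (pi_generator_res VU ge) h.
congr pair; apply/funext => i; last by case: i.
by rewrite (ord1 i).
Qed.

Let LL := dsum_sheaf line_sheaf (pshift_sheaf line_sheaf).

(* inverse of the isomorphism from E onto L + Pi L *)
Definition line_sum (U : opens X) (s : LL U) : E U := val s.1 + PE U (val s.2).

Fact line_sum_linear U : linear (@line_sum U).
Proof.
move=> a s t; rewrite /line_sum.
have -> : val (a *: s + t).2 = parity_sign a *: (val s.2 : E U) + val t.2 by [].
by rewrite (raddfD (PE U)) /= pisym_scaleE parity_signK scalerDr addrACA.
Qed.
HB.instance Definition _ U := GRing.isLinear.Build _ _ _ _ (@line_sum U)
  (@line_sum_linear U).

(** Local generators of E which are proportional, by even functions, to one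
    generator over a dense open set split E: they span a line L, and the
    sections s + Pi t with s and t in L exhaust E. *)
Lemma split_of_proportional_generators : exists L : module_sheaf X,
  locally_free 1 0 L /\ pi_isomorphic PE (split_symmetry L).
Proof.
exists line_sheaf; split; first exact: line_locally_free.
apply: (@pi_isomorphic_of_bijection X LL E _ _ (fun U => @line_sum U)) => //.
- apply: (@sheaf_bijective X LL E (fun U => @line_sum U)).
    by move=> U V VU s; rewrite [RHS](raddfD (mres VU)) /= -pisym_res.
  move=> x; have [U [Ux [e ge frame]]] := line_frame x.
  exists U; split=> // V VU; have geV := pi_generator_res VU ge.
  split=> [t|[s t] st].
    have [a [b ->]] := pi_generator_gen geV t.
    have la : in_line (a *: mres VU e) by rewrite -(comb_r0 PE); apply/frame.
    have lb : in_line (parity_sign b *: mres VU e).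
      by rewrite -(comb_r0 PE); apply/frame.
    exists (mk_line la, mk_line lb).
    rewrite [LHS]/(a *: mres VU e + PE V (parity_sign b *: mres VU e)).
    by rewrite pisym_scaleE parity_signK.
  have [a [a' sE]] := pi_generator_gen geV (val s).
  have [b [b' tE]] := pi_generator_gen geV (val t).
  have a0 : a' = 0 by apply/(frame V VU a); rewrite -sE; exact: subsheafP.
  have b0 : b' = 0 by apply/(frame V VU b); rewrite -tE; exact: subsheafP.
  move: (st : val s + PE V (val t) = 0);
    rewrite sE tE pisym_comb combD a0 b0 parity_sign0.
  rewrite addr0 add0r => h.
  have [a00 b00] : a = 0 /\ parity_sign b = 0.
    by apply: (pi_generator_inj geV); rewrite h comb_r0 scale0r.
  have b000 : b = 0 by rewrite -[b]parity_signK b00 parity_sign0.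
  congr pair; apply: val_inj; rewrite /= ?sE ?tE.
    by rewrite a00 a0 comb_r0 scale0r.
  by rewrite b000 b0 comb_r0 scale0r.
- by move=> U V VU s; rewrite [RHS](raddfD (mres VU)) /= -pisym_res.
- move=> U [s t]; rewrite [LHS](raddfD (smod_ev (E U))) /=.
  by rewrite pisym_ev.
- move=> U [s t]; rewrite [RHS](raddfD (PE U)) /= pisym_invol.
  by rewrite addrC.
Qed.

End Splitting.

(** * The line of a splitting *)

Section SplitLine.
Variables (X : superspace) (E : module_sheaf X) (PE : pi_symmetry E).
Hypothesis sq0 : odd_squares_vanish X.
Variable L : module_sheaf X.
Hypothesis L_free : locally_free 1 0 L.
Let LL := dsum_sheaf L (pshift_sheaf L).
Variable phi : forall U : opens X, {linear E U -> LL U}.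
Hypotheses (phi_bij : forall U, bijective (phi U))
  (phi_res : forall (U V : opens X) (VU : V `<=` U) s,
     phi V (mres VU s) = mres VU (phi U s))
  (phi_ev : forall U s, smod_ev (LL U) (phi U s) = phi U (smod_ev (E U) s))
  (phi_pi : forall U s, phi U (PE U s) = split_symmetry L U (phi U s)).

Lemma split_comb1 (U : opens X) (e : E U) a b : (phi U (comb PE e a b)).1 =
  a *: ((phi U e).1 : L U) + b *: ((phi U e).2 : L U).
Proof. by rewrite linearD !linearZ /= phi_pi. Qed.

Lemma split_comb2 (U : opens X) (e : E U) a b :
  ((phi U (comb PE e a b)).2 : L U) =
  parity_sign a *: ((phi U e).2 : L U) + parity_sign b *: ((phi U e).1 : L U).
Proof. by rewrite linearD !linearZ /= phi_pi. Qed.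

(** If d Pi e also lies in L, the parity conjugate of d annihilates both
    components of e, hence e itself. *)
Lemma split_line_unique (U : opens X) (e : E U) (u d : osec U) :
  pi_generator PE e -> odd_sec u -> (phi U (comb PE e 1 u)).2 = 0 ->
  (phi U (comb PE e 0 d)).2 = 0 -> d = 0.
Proof.
move=> ge hu; rewrite [LHS]split_comb2 parity_sign1 scale1r odd_parity_sign //.
rewrite scaleNr => /subr0_eq hb.
rewrite [LHS]split_comb2 parity_sign0 scale0r add0r => hd.
have du : d * u = u * parity_sign d.
  rewrite /parity_sign mulrBr -(even_commr _ (homogeneous_ev d)).
  rewrite (odd_anticomm hu (homogeneous_odd d)) opprK -mulrDl.
  by rewrite subrKC.
have : comb PE e (parity_sign d) 0 = comb PE e 0 0.
  apply: (bij_inj (phi_bij U)); rewrite [LHS]surjective_pairing.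
  rewrite [RHS]surjective_pairing; congr pair.
    by rewrite !split_comb1 hd !scale0r.
  rewrite [LHS]split_comb2 [RHS]split_comb2 parity_signK hb scalerA du.
  by rewrite -scalerA hd scaler0 parity_sign0 !scale0r.
by move=> /(pi_generator_inj ge)[h _]; rewrite -[d]parity_signK h parity_sign0.
Qed.

(** Let v be an even local generator of L and let g e + k Pi e correspond to
    (v, 0). Comparing first components shows that g is invertible, and
    dividing by g gives a section of L of the required form. *)
Lemma split_line_local (U : opens X) (e : E U) (x : X) : oset U x ->
  pi_generator PE e -> exists V : opens X, oset V x /\ exists VU : V `<=` U,
    exists2 u : osec V, odd_sec u & (phi V (comb PE (mres VU e) 1 u)).2 = 0.
Proof.
move=> Ux ge; have [N [Nx [l [m [/(_ ord0) le _ fr]]]]] := L_free x.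
pose T := opens_meet U N; pose TU := @opens_meetl _ U N;
  pose TN := @opens_meetr _ U N.
exists T; split=> //; exists TU.
have geT := pi_generator_res TU ge; move: (mres TU e) geT => f gf.
pose v := mres TN (l ord0).
have ve : even_vec v by apply: homogeneous_mres.
have vgen s : exists a, s = a *: v.
  have [c [-> _]] := fr T TN s; exists (c.1 ord0).
  by rewrite big_ord1 big_ord0 addr0.
have vinj a b : a *: v = b *: v -> a = b.
  move=> h; have [k [_ uk]] := fr T TN (a *: v).
  have := uk (fun=> a, fun=> 0).
  rewrite big_ord1 big_ord0 addr0 => /(_ erefl) kE.
  have := uk (fun=> b, fun=> 0).
  by rewrite big_ord1 big_ord0 addr0 => /(_ h);
    rewrite kE => -[/(congr1 (@^~ ord0))].
have [p pE] := vgen (phi T f).1; have [q qE] := vgen (phi T f).2.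
have [e' e'E] : exists e', phi T e' = (v, 0) by case: (phi_bij T) => h _ hK;
  exists (h (v, 0)).
have [g [k e'gk]] := pi_generator_gen gf e'.
have ev_phi s : even_vec s -> even_vec (phi T s).
  by rewrite /homogeneous phi_ev => ->.
have hp : even_sec p.
  have [ef _ _] := gf; have := congr1 fst (ev_phi _ ef).
  by rewrite /= pE smod_evZ_even // => /vinj.
have hq : odd_sec q.
  have [ef _ _] := gf; have := congr1 snd (ev_phi _ ef).
  rewrite /= /pshift_ev qE smod_evZ_even // => h.
  by apply: vinj; rewrite scale0r -(subrr (q *: v)) -{2}h subKr.
have [hg hk] : even_sec g /\ odd_sec k.
  apply: (pi_generator_even gf); rewrite -e'gk; apply: (bij_inj (phi_bij T)).
  rewrite -phi_ev e'E; congr pair; first exact: ve.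
  by rewrite /= /pshift_ev raddf0 subr0.
have gp : g * p = 1 - k * q.
  apply/eqP; rewrite eq_sym subr_eq eq_sym; apply/eqP/vinj.
  have := congr1 fst e'E; rewrite e'gk split_comb1 pE qE !scalerA -scalerDl.
  by rewrite scale1r.
pose g' := p * (1 + k * q).
have hkq : even_sec (k * q) := odd_mul_odd hk hq.
have hg' : even_sec g'.
  by apply: even_mul_even => //; apply: homogeneousD => //; exact: sring_1even.
have g'g : g' * g = 1.
  rewrite (even_commr _ hg') mulrA gp mulrDr mulr1 mulrBl mul1r.
  rewrite mulrA -(mulrA k q k) (odd_anticomm hq hk) mulrN mulrA sq0 // mul0r.
  by rewrite oppr0 mul0r subr0 subrK.
exists (g' * k); first exact: even_mul_odd.
have -> : comb PE f 1 (g' * k) = g' *: e' by rewrite e'gk combZ g'g.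
by rewrite linearZ /= e'E /= scaler0.
Qed.

(** The functions u exist locally and glue because they are unique. *)
Lemma split_line_section (U : opens X) (e : E U) : pi_generator PE e ->
  exists2 u : osec U, odd_sec u & (phi U (comb PE e 1 u)).2 = 0.
Proof.
move=> ge.
pose P (V : opens X) (u : structure_sheaf X V) := exists VU : V `<=` U,
  odd_sec (u : osec V) /\ (phi V (comb PE (mres VU e) 1 u)).2 = 0.
have [V W WV u [VU [hu uE]]|V u u' _ [VU [hu uE]] [VU' [hu' uE']]|x Ux|u hu] :=
  @glue_unique X (structure_sheaf X) U P.
- exists (subset_trans WV VU); split; first exact: homogeneous_res.
  rewrite -(mres_comp VU WV) -(rmorph1 (ores WV)) -mres_comb phi_res.
  by rewrite /= uE raddf0.
- apply/eqP; rewrite eq_sym -subr_eq0; apply/eqP.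
  apply: (split_line_unique (pi_generator_res VU ge) hu uE).
  rewrite -(subrr 1) -combB raddfB /= uE (Prop_irrelevance VU VU') uE'.
  by rewrite subrr.
- have [V [Vx [VU [u hu uE]]]] := split_line_local Ux ge.
  by exists V; split=> //; exists u, VU.
exists u.
  apply: (@mres_inj_local X (structure_sheaf X)) => x.
  move=> /hu[V [Vx [VU [_ [h _]]]]]; exists V; split=> //; exists VU.
  by rewrite /= raddf0 -ores_ev h.
apply: (@mres_inj_local X L) => x /hu[V [Vx [VU [VU' [_ h]]]]].
exists V; split=> //; exists VU.
have -> : mres VU ((phi U (comb PE e 1 u)).2 : L U) =
    (phi V (mres VU (comb PE e 1 u))).2 by rewrite phi_res.
rewrite (Prop_irrelevance VU' VU) in h.
by rewrite mres_comb rmorph1 raddf0.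
Qed.

End SplitLine.

(** * Gluing two free sheaves *)

Section Pushforward.
Variables (X : superspace) (U1 : opens X).

(** The direct image on X of the structure sheaf of the open set U1. *)
Definition push_type (U : opens X) : Type := osec (opens_meet U U1).

HB.instance Definition _ U := GRing.PzRing.on (push_type U).

Definition push_scale (U : opens X) (a : osec U) (s : push_type U) :
  push_type U := ores (@opens_meetl _ U U1) a * s.

Fact push_scaleA U a b (s : push_type U) :
  push_scale a (push_scale b s) = push_scale (a * b) s.
Proof. by rewrite /push_scale rmorphM mulrA. Qed.
Fact push_scale1 U : left_id 1 (@push_scale U).
Proof. by move=> s; rewrite /push_scale rmorph1 mul1r. Qed.
Fact push_scaleDr U : right_distributive (@push_scale U) +%R.
Proof. by move=> a s t; rewrite /push_scale mulrDr. Qed.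
Fact push_scaleDl U (s : push_type U) :
  {morph (@push_scale U)^~ s : a b / a + b}.
Proof. by move=> a b; rewrite /push_scale rmorphD mulrDl. Qed.

HB.instance Definition _ U := GRing.Zmodule_isLmodule.Build (osec U)
  (push_type U) (@push_scaleA U) (@push_scale1 U) (@push_scaleDr U)
  (@push_scaleDl U).

Fact push_grading U b c (a : osec U) (s : push_type U) :
  homogeneous (@sring_ev _) b a -> homogeneous (@sring_ev (osec _)) c s ->
  homogeneous (@sring_ev (osec (opens_meet U U1))) (b (+) c) (a *: s).
Proof. by move=> ha hs; apply: sring_grading => //; apply: homogeneous_res. Qed.

Definition push_module (U : opens X) : supermodule (osec U) :=
  @SuperModule (osec U) (push_type U) (sring_ev (osec (opens_meet U U1)))
    (@sring_ev_idem _) (@push_grading U).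

Definition push_sheaf : module_sheaf X.
Proof.
refine (@ModuleSheaf X push_module
  (fun U V VU => ores (opens_meetS VU (@subset_refl _ U1))) _ _ _ _ _).
- move=> U V VU a s; rewrite [LHS]rmorphM; congr (_ * _).
  by rewrite (ores_comp _ _ (subset_trans (@opens_meetl _ V U1) VU))
    (ores_comp _ _ (subset_trans (@opens_meetl _ V U1) VU)).
- by move=> U UU s; exact: ores_id.
- by move=> U V W VU WV WU s; exact: ores_comp.
- by move=> U V VU s; exact: ores_ev.
- move=> U I V VU s cov compat; apply: osec_glue => [x [/cov[i _ Vx] U1x]|].
    by exists i.
  move=> i j W Wi Wj.
  have W1 : W `<=` U1 by apply: subset_trans Wi (@opens_meetr _ _ _).
  have := congr1 (ores (opens_meet_max (@subset_refl _ W) W1))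
    (compat i j W (subset_trans Wi (@opens_meetl _ _ _))
       (subset_trans Wj (@opens_meetl _ _ _))).
  by rewrite !(ores_comp _ _ Wi) !(ores_comp _ _ Wj).
Defined.

End Pushforward.

Section DirectSumSymmetry.
Variables (X : superspace) (F G : module_sheaf X).
Variables (PF : pi_symmetry F) (PG : pi_symmetry G).

Definition dsum_pi (U : opens X) (s : dsum_sheaf F G U) : dsum_sheaf F G U :=
  (PF U s.1, PG U s.2).

Fact dsum_pi_additive U : zmod_morphism (@dsum_pi U).
Proof. by move=> s t; rewrite /dsum_pi !raddfB. Qed.
HB.instance Definition _ U := GRing.isZmodMorphism.Build _ _
  (@dsum_pi U) (@dsum_pi_additive U).

Definition dsum_symmetry : pi_symmetry (dsum_sheaf F G).
Proof.
refine (@PiSymmetry X (dsum_sheaf F G) (fun U => @dsum_pi U) _ _ _ _).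
- by move=> U V VU s; congr pair; apply: pisym_res.
- move=> U b s /dsum_homogeneous[h1 h2]; apply/dsum_homogeneous.
  by split; apply: pisym_odd.
- by move=> U b a s ha; congr pair; apply: pisym_scale.
- by move=> U [s t]; congr pair; apply: pisym_invol.
Defined.

End DirectSumSymmetry.

Lemma locally_free_of_generators (X : superspace) (E : module_sheaf X)
    (PE : pi_symmetry E) :
  (forall x : X, exists U : opens X, oset U x /\
     exists e : E U, pi_generator PE e) -> locally_free 1 1 E.
Proof.
move=> loc x; have [U [Ux [e ge]]] := loc x; exists U; split=> //.
exists (fun=> e), (fun=> PE U e); case: (ge) => ee gen _; split=> [//|_|V VU s].
  exact: (pisym_odd PE ee).
have [a [b sE]] := gen V VU s; exists (fun=> a, fun=> b).
split=> [|[c d]]; first by rewrite !big_ord1 -pisym_res.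
rewrite !big_ord1 -pisym_res sE /= => cd.
have [-> ->] := pi_generator_inj (pi_generator_res VU ge) cd.
by congr pair; apply/funext => i; rewrite (ord1 i).
Qed.

Section FreeSheaf.
Variables (X : superspace) (W : opens X).

Definition free_sheaf : module_sheaf X :=
  dsum_sheaf (push_sheaf W) (pshift_sheaf (push_sheaf W)).

Definition free_symmetry : pi_symmetry free_sheaf :=
  split_symmetry (push_sheaf W).

Lemma free_scale (V : opens X) (a : osec V) (s t : osec (opens_meet V W)) :
  a *: ((s, t) : free_sheaf V) =
  (ores (@opens_meetl _ V W) a * s, ores (@opens_meetl _ V W) (parity_sign a)
    * t).
Proof. by []. Qed.

Variables (E : module_sheaf X) (PE : pi_symmetry E).
Variable p : forall V : opens X, {linear E V -> free_sheaf V}.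
Hypotheses
  (p_res : forall (U V : opens X) (VU : V `<=` U) s,
     p V (mres VU s) = mres VU (p U s))
  (p_pi : forall U s, p U (PE U s) = free_symmetry U (p U s))
  (p_inj : forall V : opens X, V `<=` W -> forall s, p V s = 0 -> s = 0).

(** Injective coordinates are also surjective once some section e has
    coordinates (1, 0), since the multiples of e and Pi e attain all values. *)
Lemma pi_generator_coordinates (e : E W) :
  even_vec e -> p W e = (1, 0) -> pi_generator PE e.
Proof.
move=> ee pe.
have pV (V : opens X) (VW : V `<=` W) a b : p V (comb PE (mres VW e) a b) =
    (ores (@opens_meetl _ V W) a, ores (@opens_meetl _ V W) (parity_sign b)).
  rewrite linearD !linearZ /= p_pi p_res pe.
  have -> : mres VW ((1, 0) : free_sheaf W) = (1, 0).
    by congr pair; [exact: rmorph1|exact: raddf0].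
  have -> : free_symmetry V ((1, 0) : free_sheaf V) = (0, 1) by [].
  rewrite !free_scale !mulr1 !mulr0; congr pair; last exact: add0r.
  exact: addr0.
have VVW (V : opens X) (VW : V `<=` W) := opens_meet_max (@subset_refl _ V) VW.
split=> // V VW.
  move=> s; pose a : osec V := ores (VVW V VW) (p V s).1.
  pose b : osec V := ores (VVW V VW) (p V s).2.
  exists a, (parity_sign b).
  apply: subr0_eq; apply: p_inj => //; rewrite raddfB /= pV parity_signK.
  rewrite !(ores_comp _ _ (@subset_refl _ (opens_meet V W))) !ores_id.
  by rewrite -surjective_pairing subrr.
move=> a b ab; have := pV V VW a b; rewrite ab raddf0 => -[ha hb].
have res0 (c : osec V) : 0 = ores (@opens_meetl _ V W) c -> c = 0.
  move=> /(congr1 (ores (VVW V VW))); rewrite raddf0.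
  by rewrite (ores_comp _ _ (@subset_refl _ V)) ores_id.
by rewrite -[b]parity_signK (res0 _ ha) (res0 _ hb) parity_sign0.
Qed.

End FreeSheaf.

Section GluedSheaf.
Variables (X : superspace) (U1 U2 : opens X) (h : osec (opens_meet U1 U2)).
Hypotheses (cov : forall x : X, oset U1 x \/ oset U2 x) (ho : odd_sec h)
  (sq0 : odd_squares_vanish X).

Let ambient : module_sheaf X := dsum_sheaf (free_sheaf U1) (free_sheaf U2).

(** A section is given by s1 e1 + Pi (t1 e1) over U1 and by s2 e2 + Pi (t2 e2)
    over U2, where e2 = e1 + h Pi e1. Comparing them over every open subset W of
    the overlap makes restriction immediate. *)
Definition transition (V : opens X) (s : ambient V) : Prop :=
  forall (W : opens X) (W1 : W `<=` opens_meet V U1)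
    (W2 : W `<=` opens_meet V U2) (W12 : W `<=` opens_meet U1 U2),
  let s1 : osec W := ores W1 s.1.1 in let t1 : osec W := ores W1 s.1.2 in
  let s2 : osec W := ores W2 s.2.1 in let t2 : osec W := ores W2 s.2.2 in
  s1 = s2 + parity_sign (t2 * ores W12 h) /\
  t1 = t2 + parity_sign (s2 * ores W12 h).

Fact transition0 V : transition (0 : ambient V).
Proof.
by move=> W W1 W2 W12; rewrite /= !raddf0 !mul0r parity_sign0 addr0.
Qed.

Fact transitionD V (s t : ambient V) :
  transition s -> transition t -> transition (s + t).
Proof.
move=> hs ht W W1 W2 W12 /=.
have [/= s1 s2] := hs W W1 W2 W12; have [/= t1 t2] := ht W W1 W2 W12.
rewrite !raddfD /= s1 s2 t1 t2 !mulrDl !parity_signD.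
by split; rewrite addrACA.
Qed.

Fact transitionZ V (a : osec V) (s : ambient V) :
  transition s -> transition (a *: s).
Proof.
move=> hs W W1 W2 W12; have [/= s1 t1] := hs W W1 W2 W12.
pose WV := subset_trans W1 (@opens_meetl _ V U1).
have resM1 b (c : osec (opens_meet V U1)) :
    ores W1 (ores (@opens_meetl _ V U1) b * c) = ores WV b * ores W1 c.
  by rewrite rmorphM (ores_comp _ _ WV).
have resM2 b (c : osec (opens_meet V U2)) :
    ores W2 (ores (@opens_meetl _ V U2) b * c) = ores WV b * ores W2 c.
  by rewrite rmorphM (ores_comp _ _ WV).
have e11 : ores W1 (a *: s).1.1 = ores WV a * ores W1 s.1.1 := resM1 _ _.
have e12 : ores W1 (a *: s).1.2 = ores WV (parity_sign a) * ores W1 s.1.2 :=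
  resM1 _ _.
have e21 : ores W2 (a *: s).2.1 = ores WV a * ores W2 s.2.1 := resM2 _ _.
have e22 : ores W2 (a *: s).2.2 = ores WV (parity_sign a) * ores W2 s.2.2 :=
  resM2 _ _.
cbv zeta; rewrite e11 e12 e21 e22 s1 t1 -!parity_sign_res -!mulrA.
by rewrite ![parity_sign (_ * (_ * _))]parity_signM parity_signK -!mulrDr.
Qed.

Fact transition_ev V (s : ambient V) :
  transition s -> transition (smod_ev (ambient V) s).
Proof.
move=> hs W W1 W2 W12; have [/= s1 t1] := hs W W1 W2 W12.
rewrite /= /pshift_ev /= !raddfB /= -!ores_ev.
have hW : odd_sec (ores W12 h) by apply: homogeneous_res.
rewrite s1 t1 (raddfD _ (ores W2 s.2.1)) (raddfD _ (ores W2 s.2.2)) /=.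
rewrite !parity_sign_ev !sring_evM_odd //; split=> //.
rewrite opprD addrACA; congr (_ + _).
by rewrite -parity_signN -parity_signD -mulrBl subKr.
Qed.

Fact transition_res (V V' : opens X) (VV : V' `<=` V) (s : ambient V) :
  transition s -> transition (mres VV s).
Proof.
move=> hs W W1 W2 W12 /=.
have W1' : W `<=` opens_meet V U1 := subset_trans W1 (opens_meetS VV
  (@subset_refl _ _)).
have W2' : W `<=` opens_meet V U2 := subset_trans W2 (opens_meetS VV
  (@subset_refl _ _)).
by rewrite !(ores_comp _ _ W1') !(ores_comp _ _ W2'); apply: hs.
Qed.

Fact transition_local (V : opens X) (s : ambient V) :
  (forall x, oset V x -> exists V' : opens X, oset V' x /\
     exists VV : V' `<=` V, transition (mres VV s)) -> transition s.
Proof.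
move=> loc W W1 W2 W12 /=.
suff h' x : oset W x -> exists W' : opens X, oset W' x /\ exists WW : W' `<=` W,
    ores WW (ores W1 s.1.1) =
      ores WW (ores W2 s.2.1 + parity_sign (ores W2 s.2.2 * ores W12 h)) /\
    ores WW (ores W1 s.1.2) =
      ores WW (ores W2 s.2.2 + parity_sign (ores W2 s.2.1 * ores W12 h)).
  by split; apply: (@mres_inj_local X (structure_sheaf X)) => x
    /h'[W' [W'x [WW [e1 e2]]]]; exists W'; split=> //; exists WW.
move=> Wx; have [V' [V'x [VV hs]]] := loc x (proj1 (W1 x Wx)).
pose W' := opens_meet W V'; pose WW := @opens_meetl _ W V'.
have W1' : W' `<=` opens_meet V' U1.
  by move=> y [/W1[_ U1y] V'y].
have W2' : W' `<=` opens_meet V' U2.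
  by move=> y [/W2[_ U2y] V'y].
have [/= e1 e2] := hs W' W1' W2' (subset_trans WW W12).
exists W'; split=> //; exists WW.
rewrite (rmorphD _ (ores W2 s.2.1)) (rmorphD _ (ores W2 s.2.2)) /=.
rewrite -!parity_sign_res !rmorphM /=.
rewrite !(ores_comp _ _ (subset_trans WW W1)) !(ores_comp _ _ (subset_trans WW
  W2)).
rewrite !(ores_comp _ _ (subset_trans WW W12)).
move: e1 e2; rewrite !(ores_comp _ _ (subset_trans WW W1)).
by rewrite !(ores_comp _ _ (subset_trans WW W2)).
Qed.

Definition glued_sheaf : module_sheaf X :=
  subsheaf transition0 transitionD transitionZ transition_ev transition_res
    transition_local.

Fact transition_pi (V : opens X) (s : ambient V) : transition s ->
  transition (dsum_symmetry (free_symmetry U1) (free_symmetry U2) V s).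
Proof. by move=> hs W W1 W2 W12; have [e1 e2] := hs W W1 W2 W12. Qed.

Definition glued_symmetry : pi_symmetry glued_sheaf :=
  subsheaf_symmetry _ _ _ _ _ _ transition_pi.

Definition coord1 (V : opens X) (s : glued_sheaf V) : free_sheaf U1 V :=
  (val s).1.
Definition coord2 (V : opens X) (s : glued_sheaf V) : free_sheaf U2 V :=
  (val s).2.

Fact coord1_linear V : linear (@coord1 V). Proof. by []. Qed.
HB.instance Definition _ V := GRing.isLinear.Build _ _ _ _ (@coord1 V)
  (@coord1_linear V).
Fact coord2_linear V : linear (@coord2 V). Proof. by []. Qed.
HB.instance Definition _ V := GRing.isLinear.Build _ _ _ _ (@coord2 V)
  (@coord2_linear V).

(** When the coordinates over U1 vanish, those over U2 satisfy
    t2 = parity_sign s2 * h and s2 = - parity_sign (t2 * h), and h is of square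
    zero. *)
Lemma coord1_inj (V : opens X) : V `<=` U1 ->
  forall s : glued_sheaf V, coord1 s = 0 -> s = 0.
Proof.
move=> V1 s s0; apply: val_inj; have := subsheafP s; move: s0.
rewrite /coord1; case: (val s) => s1 [s2 t2] /= -> hs.
have V21 : opens_meet V U2 `<=` opens_meet V U1 by move=> x [Vx _];
  split=> //; exact: V1.
have V12 : opens_meet V U2 `<=` opens_meet U1 U2 by move=> x [/V1].
have [/=] := hs (opens_meet V U2) V21 (@subset_refl _ _) V12.
have hW : odd_sec (ores V12 h) := homogeneous_res V12 ho.
rewrite !ores_id raddf0 => /esym/eqP; rewrite addr_eq0 => /eqP s2E.
move/esym/eqP; rewrite addr_eq0 => /eqP t2E.
have t20 : t2 = 0 :> osec (opens_meet V U2).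
  rewrite [LHS]t2E s2E mulNr !parity_signN opprK parity_signM.
  by rewrite parity_signK odd_parity_sign // -mulrA mulrN sq0 // oppr0 mulr0.
have s20 : s2 = 0 :> osec (opens_meet V U2).
  by rewrite [LHS]s2E t20 mul0r parity_sign0 oppr0.
by rewrite t20 s20.
Qed.

Lemma coord2_inj (V : opens X) : V `<=` U2 ->
  forall s : glued_sheaf V, coord2 s = 0 -> s = 0.
Proof.
move=> V2 s s0; apply: val_inj; have := subsheafP s; move: s0.
rewrite /coord2; case: (val s) => [[s1 t1] s2] /= -> hs.
have V12 : opens_meet V U1 `<=` opens_meet V U2 by move=> x [Vx _];
  split=> //; exact: V2.
have V11 : opens_meet V U1 `<=` opens_meet U1 U2 by move=> x [/V2].
have [/=] := hs (opens_meet V U1) (@subset_refl _ _) V12 V11.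
by rewrite !ores_id !raddf0 !mul0r parity_sign0 addr0 => -> ->.
Qed.

(* e1 = e2 - h Pi e2 = e2 + Pi (h e2) *)
Fact generator1_transition : transition (((1, 0), (1, h)) : ambient U1).
Proof.
move=> W W1 W2 W12 /=; rewrite !rmorph1 raddf0 mul1r.
have hW : odd_sec (ores W12 h) := homogeneous_res W12 ho.
rewrite (Prop_irrelevance W2 W12) sq0 // parity_sign0 addr0.
by rewrite odd_parity_sign // subrr.
Qed.

Fact chart_swap : opens_meet U2 U1 `<=` opens_meet U1 U2.
Proof. by move=> x []. Qed.

(* e2 = e1 + h Pi e1 = e1 - Pi (h e1) *)
Fact generator2_transition :
  transition (((1, - ores chart_swap h), (1, 0)) : ambient U2).
Proof.
move=> W W1 W2 W12 /=; rewrite !rmorph1 raddf0 mul1r mul0r parity_sign0.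
have hW : odd_sec (ores W12 h) := homogeneous_res W12 ho.
by rewrite addr0 rmorphN /= (ores_comp _ _ W12) odd_parity_sign // add0r.
Qed.

Definition generator1 : glued_sheaf U1 := mk_subsheaf generator1_transition.
Definition generator2 : glued_sheaf U2 := mk_subsheaf generator2_transition.

Lemma generator1P : pi_generator glued_symmetry generator1.
Proof.
apply: (@pi_generator_coordinates X U1 _ _ (fun V => @coord1 V)) => //.
  exact: coord1_inj.
apply/subsheaf_homogeneous; rewrite /homogeneous /= /dsum_ev /=.
rewrite /dsum_ev /= /pshift_ev /= raddf0 ho !subr0.
by rewrite ![sring_ev _ 1](sring_1even (osec _)).
Qed.

Lemma generator2P : pi_generator glued_symmetry generator2.
Proof.
apply: (@pi_generator_coordinates X U2 _ _ (fun V => @coord2 V)) => //.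
  exact: coord2_inj.
apply/subsheaf_homogeneous; rewrite /homogeneous /= /dsum_ev /=.
have hh : odd_sec (- ores chart_swap h).
  by apply: homogeneousN; apply: homogeneous_res.
rewrite /dsum_ev /= /pshift_ev /= raddf0 hh !subr0.
by rewrite ![sring_ev _ 1](sring_1even (osec _)).
Qed.

Lemma generator_transition : mres (@opens_meetr _ U1 U2) generator2 =
  comb glued_symmetry (mres (@opens_meetl _ U1 U2) generator1) 1 h.
Proof.
apply: subr0_eq; apply: coord2_inj; first exact: opens_meetr.
have hM : opens_meet (opens_meet U1 U2) U2 `<=`
  opens_meet U1 U2 := @opens_meetl _ _ _.
have e1 : coord2 (mres (@opens_meetl _ U1 U2) generator1) = (1, ores hM h).
  congr pair; first exact: rmorph1.
  exact: (congr1 (fun H => ores H h) (Prop_irrelevance _ hM)).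
have e2 : coord2 (mres (@opens_meetr _ U1 U2) generator2) = (1, 0).
  by congr pair; [exact: rmorph1|exact: raddf0].
have e3 : coord2 (comb glued_symmetry (mres (@opens_meetl _ U1 U2) generator1)
  1 h) =
    1 *: coord2 (mres (@opens_meetl _ U1 U2) generator1) + h *: free_symmetry
      U2 _
      (coord2 (mres (@opens_meetl _ U1 U2) generator1)) by [].
rewrite raddfB /= e2 e3 e1 scale1r.
have -> : free_symmetry U2 _ ((1, ores hM h) : free_sheaf U2 (opens_meet U1
  U2)) =
  (ores hM h, 1) by [].
rewrite free_scale (Prop_irrelevance (@opens_meetl _ _ _) hM).
rewrite -rmorphM /= sq0 // raddf0 mulr1 odd_parity_sign // rmorphN.
have -> : ((1, ores hM h) : free_sheaf U2 (opens_meet U1 U2)) + (0, - ores hM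
  h) = (1, 0).
  by congr pair; [exact: addr0|exact: subrr].
exact: subrr.
Qed.

Definition glued_pi_sheaf : pi_invertible_sheaf X.
Proof.
refine (@PiInvertible X glued_sheaf _ glued_symmetry).
apply: locally_free_of_generators => x; have [Ux|Ux] := cov x.
  by exists U1; split=> //; exists generator1; exact: generator1P.
by exists U2; split=> //; exists generator2; exact: generator2P.
Defined.

End GluedSheaf.

(** The line of a splitting contains e1 + a Pi e1 and e2 + b Pi e2; substituting
    e2 = e1 + h Pi e1 gives (1 - b h) e1 + (h + b) Pi e1 on the overlap, which
    must be 1 - b h times the former. *)
Lemma glued_split (X : superspace) (U1 U2 : opens X)
    (h : osec (opens_meet U1 U2))
    (cov : forall x : X, oset U1 x \/ oset U2 x) (ho : odd_sec h)
    (sq0 : odd_squares_vanish X) :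
  pi_split (glued_pi_sheaf cov ho sq0) ->
  exists (a : osec U1) (b : osec U2), [/\ odd_sec a, odd_sec b &
    h + ores (@opens_meetr _ U1 U2) b =
    (1 - ores (@opens_meetr _ U1 U2) b * h) * ores (@opens_meetl _ U1 U2) a].
Proof.
move=> [L [lf [phi [bij res phi_ev phi_pi]]]].
have g1 : pi_generator (pi_sym (glued_pi_sheaf cov ho sq0)) (generator1 ho sq0).
  exact: generator1P.
have g2 : pi_generator (pi_sym (glued_pi_sheaf cov ho sq0)) (generator2 ho).
  exact: generator2P.
have [a ha aE] := split_line_section sq0 lf bij res phi_ev phi_pi g1.
have [b hb bE] := split_line_section sq0 lf bij res phi_ev phi_pi g2.
exists a, b; split=> //; apply: subr0_eq.
apply: (split_line_unique bij phi_pi (pi_generator_res (@opens_meetl _ U1 U2)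
  g1)
  (homogeneous_res (@opens_meetl _ U1 U2) ha)).
  by rewrite -(rmorph1 (ores (@opens_meetl _ U1 U2))) -mres_comb res /= aE
    raddf0.
set a' := ores _ a; set b' := ores _ b; set E := glued_pi_sheaf cov ho sq0.
set e1 := mres _ (generator1 ho sq0).
have -> : comb (pi_sym E) e1 0 (h + b' - (1 - b' * h) * a') =
    comb (pi_sym E) (comb (pi_sym E) e1 1 h) 1 b' -
    (1 - b' * h) *: comb (pi_sym E) e1 1 a'.
  rewrite comb_comb combZ combB !mul1r !mulr1 parity_sign1 mulr1.
  by rewrite odd_parity_sign // mulrN subrr.
have kerB (s t : E (opens_meet U1 U2)) : (phi _ s).2 = 0 -> (phi _ t).2 = 0 ->
    (phi _ (s - t)).2 = 0.
  by move=> hs ht; rewrite raddfB /= hs ht subr0.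
have kerZ (c : osec (opens_meet U1 U2)) (s : E (opens_meet U1 U2)) :
    (phi _ s).2 = 0 -> (phi _ (c *: s)).2 = 0.
  by move=> hs; rewrite linearZ /= hs scaler0.
apply: kerB; last apply: kerZ.
  rewrite -generator_transition -(rmorph1 (ores (@opens_meetr _ U1 U2)))
    -mres_comb.
  by rewrite res /= bE raddf0.
rewrite -(rmorph1 (ores (@opens_meetl _ U1 U2))) -mres_comb.
by rewrite res /= aE raddf0.
Qed.

(** * Splittings from additive shifts *)

Definition odd_cubes_vanish (X : superspace) : Prop :=
  forall (U : opens X) (a b c : osec U),
    odd_sec a -> odd_sec b -> odd_sec c -> a * b * c = 0.

Section SplittingByShifts.
Variables (X : superspace) (E : module_sheaf X) (PE : pi_symmetry E).
Hypothesis sq0 : odd_squares_vanish X.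

Lemma pi_generator_ratio (U : opens X) (e0 e : E U) :
  pi_generator PE e0 -> pi_generator PE e -> exists g h : osec U,
    [/\ even_sec g, odd_sec h & e = g *: comb PE e0 1 h].
Proof.
move=> ge0 ge; have [g [k [g' [-> hg hk hg' g'g]]]] := pi_generator_change sq0
  ge0 ge.
exists g, (g' * k); split=> //; first exact: even_mul_odd.
by rewrite combZ mulr1 mulrA (even_commr g' hg) g'g mul1r.
Qed.

Variables (U0 : opens X) (e0 : E U0) (r : osec U0).

(** When products of three odd functions vanish, multiplying generators adds
    their shifts: the line of e0 + r Pi e0 coincides with the line of
    e + u Pi e as soon as r = h + u, where e is proportional to
    e0 + h Pi e0. *)
Lemma split_of_shifts : odd_cubes_vanish X ->
  (forall (U : opens X) (f : osec U),
     ores (@opens_meetl _ U U0) f = 0 -> f = 0) ->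
  pi_generator PE e0 -> odd_sec r ->
  (forall x : X, exists U : opens X, oset U x /\ exists (e : E U) (u : osec U)
     (g h : osec (opens_meet U U0)),
     [/\ pi_generator PE e, odd_sec u, even_sec g /\ odd_sec h,
       mres (@opens_meetl _ U U0) e =
         g *: comb PE (mres (@opens_meetr _ U U0) e0) 1 h
     & ores (@opens_meetr _ U U0) r = h + ores (@opens_meetl _ U U0) u]) ->
  exists L : module_sheaf X,
    locally_free 1 0 L /\ pi_isomorphic PE (split_symmetry L).
Proof.
move=> cube0 dense ge0 hr loc.
have ge0' := pi_generator_shift sq0 hr ge0.
apply: (split_of_proportional_generators ge0' dense _ sq0) => x.
have [U [Ux [e [u [g [h [ge hu [hg hh] eE rE]]]]]]] := loc x.
exists U; split=> //; exists (comb PE e 1 u); first exact: pi_generator_shift.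
have hgh : odd_sec (g * h) := even_mul_odd hg hh.
have huT := homogeneous_res (@opens_meetl _ U U0) hu.
exists (g - ores (@opens_meetl _ U U0) u * (g * h)).
  by apply: homogeneousB => //; apply: odd_mul_odd.
rewrite !mres_comb !rmorph1 eE !combZ !mulr1 comb_comb !mul1r.
rewrite (odd_parity_sign hgh) (even_parity_sign hg) mulrN; congr comb.
rewrite mulrBl cube0 ?subr0 //; last exact: homogeneous_res.
by rewrite rE mulrDr (even_commr (ores _ u) hg).
Qed.

End SplittingByShifts.

(** * Exterior algebras *)

Section ExteriorOrder.
Variables (K : comNzRingType) (m : nat).
Implicit Types x y z : exterior K m.

(** Membership in the n-th power of the ideal generated by the odd variables. *)
Definition order_ge (n : nat) (x : exterior K m) : Prop :=
  forall I : {set 'I_m}, (#|I| < n)%N -> coef x I = 0.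

Lemma order_geM n p x y :
  order_ge n x -> order_ge p y -> order_ge (n + p)%N (x * y).
Proof.
move=> hx hy I In; rewrite Defs.coefM big1 // => J JI.
have [Jn|nJ] := ltnP #|J| n; first by rewrite hx // mul0r mulr0.
rewrite (hy (I :\: J)%SET) ?mulr0 //.
by rewrite -(ltn_add2l #|J|) -card_subsetD // (leq_trans In) // leq_add2r.
Qed.

Lemma order_ge_odd x : homogeneous (@ext_ev K m) true x -> order_ge 1 x.
Proof.
move=> /(ext_evP true) hx I; rewrite ltnS leqn0 => /eqP I0.
by apply: hx; rewrite I0.
Qed.

Lemma order_ge0 n x : (m < n)%N -> order_ge n x -> x = 0.
Proof.
move=> mn hx; apply/extP => I; rewrite Defs.coef0 hx // (leq_ltn_trans _ mn) //.
by rewrite -[leqRHS]card_ord max_card.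
Qed.

Lemma ext_odd_cube x y z : (m <= 2)%N -> homogeneous (@ext_ev K m) true x ->
  homogeneous (@ext_ev K m) true y -> homogeneous (@ext_ev K m) true z ->
  x * y * z = 0.
Proof.
move=> m2 /order_ge_odd hx /order_ge_odd hy /order_ge_odd hz.
exact: (@order_ge0 3 _ m2 (order_geM (order_geM hx hy) hz)).
Qed.

Definition monomial (I : {set 'I_m}) (c : K) : exterior K m :=
  [ffun J : {set 'I_m} => if J == I then c else 0].

Lemma coef_monomial I c J : coef (monomial I c) J = if J == I then c else 0.
Proof. by rewrite /coef ffunE. Qed.

Lemma rescale_monomial t I c :
  rescale t (monomial I c) = monomial I (t ^+ #|I| * c).
Proof.
apply/extP => J; rewrite coef_rescale !coef_monomial.
by case: eqP => [->|_]; rewrite ?mulr0.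
Qed.

Lemma monomial_odd (I : {set 'I_m}) c :
  odd #|I| -> homogeneous (@ext_ev K m) true (monomial I c).
Proof.
move=> oI; apply/(ext_evP true) => J; rewrite coef_monomial.
by have [->|//] := eqVneq J I; rewrite oI.
Qed.

End ExteriorOrder.

(** * Functions on the projective superline *)

Section Sections.
Variables (K : numClosedFieldType) (m : nat).
Local Notation X := (proj_superspace K m).
Implicit Types (U V : opens X).

Definition zpart U (f : osec U) : (@chart_z K @^-1` U) -> exterior K m :=
  (proj_val (f : proj_section m U)).1.
Definition wpart U (f : osec U) : (@chart_w K @^-1` U) -> exterior K m :=
  (proj_val (f : proj_section m U)).2.

Lemma zwpart U (f : osec U) (z : @chart_z K @^-1` U) (w : @chart_w K @^-1` U) :
  val z * val w = 1 -> wpart f w = rescale (val z) (zpart f z).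
Proof. by have [_ _] := proj_sectionP f; apply. Qed.

Lemma homogeneous_pointwise U b (f : osec U) : homogeneous (@sring_ev _) b f <->
  (forall z, homogeneous (@ext_ev K m) b (zpart f z)) /\
  (forall w, homogeneous (@ext_ev K m) b (wpart f w)).
Proof.
split; first exact: (@proj_homogeneous K m U b).
move=> [hz hw]; apply: (@proj_section_eq K m U) => x.
  by rewrite [LHS]hz; case: (b).
by rewrite [LHS]hw; case: (b).
Qed.

Lemma proj_odd_squares : odd_squares_vanish X.
Proof.
move=> U a ha; have aa := odd_anticomm ha ha.
suff ext0 (x : exterior K m) : x = - x -> x = 0.
  apply: (@proj_section_eq K m U) => x; apply: ext0.
    by rewrite -[RHS]/(zpart (- (a * a)) x) -aa.
  by rewrite -[RHS]/(wpart (- (a * a)) x) -aa.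
move=> xx; apply/extP => I; rewrite Defs.coef0.
have /eqP := congr1 (fun y => coef y I) xx;
  rewrite /= Defs.coefN -addr_eq0 -mulr2n.
by rewrite mulrn_eq0 => /eqP.
Qed.

Lemma proj_odd_cubes : (m <= 2)%N -> odd_cubes_vanish X.
Proof.
move=> m2 U a b c /homogeneous_pointwise[az aw] /homogeneous_pointwise[bz bw].
move=> /homogeneous_pointwise[cz cw]; apply: (@proj_section_eq K m U) => x.
  exact: (ext_odd_cube m2 (az x) (bz x) (cz x)).
exact: (ext_odd_cube m2 (aw x) (bw x) (cw x)).
Qed.

End Sections.

(** * Regular functions are rational *)

Section Rational.
Variable K : numClosedFieldType.
Implicit Types (p q M Q : {poly K}) (s : seq K).

Lemma infinite_avoid s : exists x : K, x \notin s.
Proof.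
apply: contrapT => h.
have us : uniq [seq (n%:R : K) | n <- iota 0 (size s).+1].
  by rewrite map_inj_uniq ?iota_uniq // => i j /eqP; rewrite eqr_nat => /eqP.
have sub : {subset [seq (n%:R : K) | n <- iota 0 (size s).+1] <= s}.
  by move=> x _; apply: contrapT => /negP xs; apply: h; exists x.
by have := uniq_leq_size us sub; rewrite size_map size_iota ltnn.
Qed.

Lemma poly_roots p : p != 0 -> exists s, forall x, x \notin s -> p.[x] != 0.
Proof.
move=> p0; have [s ps] := closed_field_poly_normal p.
exists s => x xs; rewrite ps hornerZ mulf_neq0 ?lead_coef_eq0 //.
by rewrite -/(root _ _) root_prod_XsubC.
Qed.

Lemma poly_cofinite0 p s : (forall x, x \notin s -> p.[x] = 0) -> p = 0.
Proof.
move=> hp; apply/eqP; apply: contraT => /poly_roots[t ht].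
have [x] := infinite_avoid (s ++ t); rewrite mem_cat negb_or => /andP[xs xt].
by have := ht x xt; rewrite hp ?eqxx.
Qed.

Lemma zariski_open_cofinite (A : set K) x : zariski_open A -> A x ->
  exists s, forall y, y \notin s -> A y.
Proof.
move=> [S ->] [p Sp px]; have p0 : p != 0.
  by apply: contraNneq px => ->; rewrite horner0.
by have [s hs] := poly_roots p0; exists s => y /hs py; exists p.
Qed.

Variable A : set K.
Implicit Types f g : A -> K.

Lemma regular_rational f (a : A) : regular f ->
  exists M Q, Q != 0 /\ forall x : A, Q.[val x] != 0 ->
    f x = M.[val x] / Q.[val x].
Proof.
move=> /(_ a)[M [Q [Qa fE]]]; exists M, Q; split=> //.
by apply: contraNneq Qa => ->; rewrite horner0.
Qed.

Lemma regular_eq f g s : zariski_open A -> regular f -> regular g ->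
  (forall x : A, val x \notin s -> f x = g x) -> f =1 g.
Proof.
move=> oA hf hg fg a.
have [t At] := zariski_open_cofinite oA (set_mem (valP a)).
have [p [q [qa fE]]] := hf a; have [p' [q' [q'a gE]]] := hg a.
rewrite fE // gE //; apply/eqP; rewrite eqr_div // -subr_eq0.
suff : (p * q' - p' * q) * (q * q') = 0.
  move=> /eqP; rewrite mulf_eq0 => /orP[/eqP pq|].
    by rewrite -!hornerM -hornerN -hornerD pq horner0.
  by rewrite mulf_eq0 => /orP[] /eqP q0; [move: qa|move: q'a];
    rewrite q0 horner0 eqxx.
apply: (@poly_cofinite0 _ (s ++ t)) => x;
  rewrite mem_cat negb_or => /andP[xs xt].
have [q0|qx] := eqVneq q.[x] 0; first by rewrite !hornerM q0 mul0r mulr0.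
have [q0|q'x] := eqVneq q'.[x] 0; first by rewrite !hornerM q0 !mulr0.
pose y : A := exist _ x (mem_set (At x xt)).
have /eqP := fg y xs; rewrite fE // gE // eqr_div // => /eqP /= e.
by rewrite hornerM hornerD hornerN !hornerM e subrr mul0r.
Qed.

(** A regular function on the whole affine line is a polynomial: the reduced
    denominator of its expression as a fraction has no root. *)
Lemma regular_polynomial f : (forall x, A x) -> regular f ->
  exists p, forall x : A, f x = p.[val x].
Proof.
move=> AT hf; pose pt x : A := exist _ x (mem_set (AT x)).
have [M [Q [Q0 fE]]] := regular_rational (pt 0) hf.
pose d := gcdp M Q; have d0 : d != 0 by rewrite gcdp_eq0 (negPf Q0) andbF.
have ME : M = M %/ d * d by rewrite divpK // dvdp_gcdl.
have QE : Q = Q %/ d * d by rewrite divpK // dvdp_gcdr.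
have cop : coprimep (Q %/ d) (M %/ d).
  by rewrite coprimep_sym coprimep_div_gcd // Q0 orbT.
set M' := M %/ d in ME cop; set Q' := Q %/ d in QE cop.
have key x : Q'.[x] != 0 /\ f (pt x) = M'.[x] / Q'.[x].
  have [p [q [qx fq]]] := hf (pt x); rewrite /= in qx.
  have e : M' * q = p * Q'.
    apply/eqP; rewrite -subr_eq0; apply/eqP.
    suff : (M' * q - p * Q') * (q * Q) = 0.
      move=> /eqP; rewrite mulf_eq0 => /orP[/eqP //|].
      rewrite mulf_eq0 (negPf Q0) orbF => /eqP q0.
      by move: qx; rewrite q0 horner0 eqxx.
    apply: (@poly_cofinite0 _ [::]) => y _.
    have [q0|qy] := eqVneq q.[y] 0; first by rewrite !hornerM q0 mul0r mulr0.
    have [QQ|Qy] := eqVneq Q.[y] 0; first by rewrite !hornerM QQ !mulr0.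
    have dy : d.[y] != 0 by move: Qy;
      rewrite QE hornerM mulf_eq0 negb_or => /andP[].
    have Q'y : Q'.[y] != 0.
      by move: Qy; rewrite QE hornerM mulf_eq0 negb_or => /andP[].
    have := fE (pt y) Qy; rewrite (fq (pt y) qy) /= ME QE !hornerM.
    rewrite -mulf_div divff // mulr1 => /eqP; rewrite eqr_div // => /eqP e.
    by rewrite hornerD hornerN !hornerM e subrr mul0r.
  have Q'x : Q'.[x] != 0.
    have /dvdpP[c qE] : Q' %| q.
      by rewrite -(Gauss_dvdpr _ cop) e dvdp_mull.
    by move: qx; rewrite qE hornerM mulf_eq0 negb_or => /andP[].
  split=> //; rewrite fq //=; apply/eqP; rewrite eqr_div //.
  by rewrite -!hornerM e.
have Q'1 : size Q' = 1.
  apply/eqP; apply: contraT => /closed_rootP[x]; rewrite /root => Q'x.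
  by have [] := key x; rewrite Q'x.
have /eqP/size_poly1P[c c0 Q'c] := Q'1.
exists (c^-1 *: M') => x.
have -> : x = pt (val x) by apply: val_inj.
by rewrite (key _).2 Q'c hornerC hornerZ mulrC.
Qed.

End Rational.

Section ProjectiveSections.
Variables (K : numClosedFieldType) (m : nat).
Local Notation X := (proj_superspace K m).
Implicit Types (U V : opens X).

Lemma opens_zchart U : zariski_open (@chart_z K @^-1` U).
Proof. by have [] := oset_open U. Qed.
Lemma opens_wchart U : zariski_open (@chart_w K @^-1` U).
Proof. by have [] := oset_open U. Qed.

Lemma opens_cofinite U x : oset U x ->
  exists s : seq K, forall z, z \notin s -> oset U (Some z).
Proof.
case: x => [a|] Ux.
  exact: (zariski_open_cofinite (opens_zchart U) (x := a)).
have U0 : (@chart_w K @^-1` U) 0 by rewrite /= /chart_w eqxx.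
have [s hs] := zariski_open_cofinite (opens_wchart U) U0.
exists (0 :: [seq w^-1 | w <- s]) => z; rewrite inE negb_or => /andP[z0 zs].
have := hs z^-1; rewrite /= /chart_w invr_eq0 (negPf z0) invrK; apply.
by apply: contraNN zs => zs; rewrite -[z]invrK map_f.
Qed.

(** The coefficients are rational functions, and a polynomial with infinitely
    many zeros vanishes. *)
Lemma section_eq U (f g : osec U) (s : seq K) :
  (forall z : @chart_z K @^-1` U, val z \notin s -> zpart f z = zpart g z) ->
  f = g.
Proof.
move=> fg; have [fz fw _] := proj_sectionP f; have [gz gw _] := proj_sectionP g.
apply: (@proj_section_eq K m U) => x; apply: extP => I.
  apply: (regular_eq (opens_zchart U) (fz I) (gz I) (s := s)) => z zs.
  by have := fg z zs; rewrite /zpart => ->.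
apply: (regular_eq (opens_wchart U) (fw I) (gw I)
  (s := 0 :: [seq z^-1 | z <- s])) => w.
rewrite inE negb_or => /andP[w0 ws].
have zU : (val w)^-1 \in @chart_z K @^-1` U.
  apply: mem_set; have := set_mem (valP w).
  by rewrite /= /chart_w (negPf w0).
pose z : @chart_z K @^-1` U := exist _ (val w)^-1 zU.
have zw : val z * val w = 1 by rewrite /= mulVf.
have := zwpart f zw; have := zwpart g zw; rewrite /wpart => -> ->.
rewrite fg //; apply: contraNN ws => ws.
by rewrite -[val w]invrK map_f.
Qed.

Lemma section_rational U x (f : osec U) I : oset U x -> exists M Q,
  Q != 0 /\ forall z : @chart_z K @^-1` U, Q.[val z] != 0 ->
    coef (zpart f z) I = M.[val z] / Q.[val z].
Proof.
move=> /opens_cofinite[s hs]; have [z zs] := infinite_avoid s.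
have [fz _ _] := proj_sectionP f.
exact: (regular_rational (exist _ z (mem_set (hs z zs))) (fz I)).
Qed.

Lemma res_dense U U0 x : oset U0 x -> forall f : osec U,
  ores (@opens_meetl _ U U0) f = 0 -> f = 0.
Proof.
move=> /opens_cofinite[s hs] f f0; apply: (@section_eq U f 0 s) => z zs.
have zU : val z \in @chart_z K @^-1` (opens_meet U U0).
  by apply: mem_set; split; [exact: (set_mem (valP z))|exact: hs].
have := congr1 (fun g : osec (opens_meet U U0) => zpart g (exist _ (val z)
  zU)) f0.
rewrite [X in X = _ -> _]/(zpart f (chart_incl (@opens_meetl _ U U0) (exist _
  (val z) zU))).
by have -> : chart_incl (@opens_meetl _ U U0) (exist _ (val z) zU) = z by
  apply: val_inj.
Qed.

End ProjectiveSections.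

(** * Sections given by one rational coefficient *)

Section RationalSections.
Variables (K : numClosedFieldType) (m : nat).
Local Notation X := (proj_superspace K m).
Implicit Types (U V : opens X).

(** The polynomial w^(n-1) p(1/w), which expresses p in the coordinate
    w = 1/z. *)
Definition reverse_poly (n : nat) (p : {poly K}) : {poly K} :=
  \poly_(j < n) p`_(n.-1 - j).

Lemma horner_reverse n (p : {poly K}) (w : K) : (size p <= n)%N -> w != 0 ->
  (reverse_poly n p).[w] * w = w ^+ n * p.[w^-1].
Proof.
move=> pn w0; rewrite horner_poly (horner_coef_wide _ pn) mulr_suml mulr_sumr.
rewrite (reindex_inj rev_ord_inj) /=; apply: eq_bigr => i _.
have ni : (n.-1 - (n - i.+1) = i)%N by case: n i {pn} => [[]|n i] //=;
  rewrite subSS subKn // -ltnS.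
rewrite ni -mulrA -exprSr subnSK // mulrCA; congr (_ * _).
have -> : w ^+ n = w ^+ (n - i) * w ^+ i by rewrite -exprD subnK // ltnW.
by rewrite -mulrA -exprMn divff // expr1n mulr1.
Qed.

Lemma horner_reverse0 n (p : {poly K}) : (reverse_poly n.+1 p).[0] = p`_n.
Proof. by rewrite horner_coef0 coef_poly subn0. Qed.

(** The section M / Q times a monomial of degree k + 1, that is, M / Q as a
    section of O(-k-1): in the coordinate w it reads w^(-k-1) M(1/w) / Q(1/w),
    and it extends to infinity when M / Q vanishes there to order k + 1. *)
Section OneCoefficient.
Variables (U : opens X) (I : {set 'I_m}) (k : nat) (M Q : {poly K}).
Hypotheses (Ik : #|I| = k.+1)
  (Qz : forall z, oset U (Some z) -> Q.[z] != 0)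
  (Qoo : oset U None -> (size M + k < size Q)%N).

(* large enough for M and Q to be reversed, and equal to the degree of Q if U
   contains infinity, so that Qw does not vanish there *)
Let d := maxn (size M + k) (size Q).-1.
Let Mw := reverse_poly (d - k) M.
Let Qw := reverse_poly d.+1 Q.

Lemma rational_chart_w (w : K) : w != 0 ->
  Mw.[w] * w ^+ k.+1 = w ^+ d * M.[w^-1] /\ Qw.[w] = w ^+ d * Q.[w^-1].
Proof.
move=> w0; have kd : (size M + k <= d)%N := leq_maxl _ _.
have kd' : (k <= d)%N := leq_trans (leq_addl _ _) kd.
split.
  rewrite exprS mulrA horner_reverse //; last by rewrite leq_subRL // addnC.
  by rewrite mulrAC -exprD subnK.
apply: (mulIf w0); rewrite horner_reverse //; first by rewrite exprSr mulrAC.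
by rewrite (leq_trans (leqSpred _)) // ltnS leq_maxr.
Qed.

Lemma rational_chart_w_neq0 (w : K) : oset U (chart_w w) -> Qw.[w] != 0.
Proof.
have [->|w0] := eqVneq w 0.
  rewrite /chart_w eqxx => /Qoo MQ; rewrite horner_reverse0.
  have -> : d = (size Q).-1 by rewrite /d; apply/maxn_idPr;
    rewrite -ltnS (ltn_predK MQ).
  by rewrite -lead_coefE lead_coef_eq0 -size_poly_gt0 (leq_ltn_trans _ MQ).
rewrite /chart_w (negPf w0) => /Qz Qw0.
by rewrite (rational_chart_w w0).2 mulf_neq0 // expf_neq0.
Qed.

Lemma regular_monomial (A : set K) (p q : {poly K}) :
  (forall x, A x -> q.[x] != 0) ->
  super_regular (fun x : A => monomial I (p.[val x] / q.[val x])).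
Proof.
move=> q0 J; under eq_fun do rewrite coef_monomial.
case: eqP => _; last exact: regular_cst.
by move=> a; exists p, q; split=> //; apply: q0; exact: set_mem (valP a).
Qed.

Fact rational_glued : glued ((fun z => monomial I (M.[val z] / Q.[val z]),
  fun w => monomial I (Mw.[val w] / Qw.[val w])) : chart_sections m U).
Proof.
split=> [||z w zw] /=.
- exact: (@regular_monomial _ M Q Qz).
- exact: (@regular_monomial _ Mw Qw rational_chart_w_neq0).
have w0 : val w != 0.
  by apply: contra_eq_neq zw => ->; rewrite mulr0 eq_sym oner_neq0.
have zE : val z = (val w)^-1 by apply: (mulIf w0); rewrite zw mulVf.
have Qz0 : Q.[val z] != 0 by apply: Qz; exact: set_mem (valP z).
have [Me Qe] := rational_chart_w w0.
rewrite rescale_monomial Ik; congr monomial; rewrite Qe zE exprVn.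
have wk : val w ^+ k.+1 != 0 by rewrite expf_neq0.
apply: (mulIf wk); rewrite mulrAC Me -mulf_div divff ?expf_neq0 // mul1r.
by rewrite [RHS]mulrAC mulVf // mul1r.
Qed.

Definition rational_section : osec U := mk_section rational_glued.

Lemma rational_sectionE z :
  zpart rational_section z = monomial I (M.[val z] / Q.[val z]).
Proof. by []. Qed.

Lemma rational_section_odd : odd k.+1 -> odd_sec rational_section.
Proof.
move=> ok; apply/homogeneous_pointwise.
by split=> x; apply: monomial_odd; rewrite Ik.
Qed.

End OneCoefficient.

End RationalSections.

Section PointComplements.
Variable K : numClosedFieldType.

Lemma zariski_open_poly (p : {poly K}) : zariski_open [set x | p.[x] != 0].
Proof.
exists [set p]; apply/seteqP; split=> x /=; first by exists p.
by move=> [_ ->].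
Qed.

Lemma point_complement_open (x : proj_line K) : open [set y | y != x].
Proof.
suff [p [q [hp hq]]] : exists p q : {poly K},
    (forall z, (p.[z] != 0) = (chart_z z != x)) /\
    (forall w, (q.[w] != 0) = (chart_w w != x)).
  split; rewrite /preimage /=; under eq_set do rewrite -?hp -?hq;
  exact: zariski_open_poly.
case: x => [a|].
  exists ('X - a%:P), (1 - a *: 'X); split=> x; rewrite !hornerE.
    by rewrite subr_eq0.
  rewrite /chart_w; have [->|x0] := eqVneq x 0;
    first by rewrite mulr0 subr0 oner_eq0.
  rewrite subr_eq0; congr (~~ _); apply/eqP/eqP => [e|[<-]];
    last by rewrite mulVf.
  by congr Some; apply: (mulIf x0); rewrite mulVf.
exists 1, 'X; split=> x; first by rewrite hornerE oner_eq0.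
by rewrite hornerE /chart_w; case: (x == 0).
Qed.

Fact avoid_open (ps : seq (proj_line K)) : open [set y | y \notin ps].
Proof.
elim: ps => [|x ps IH].
  have -> : [set y : proj_line K | y \notin [::]] = setT by apply/seteqP.
  exact: openT.
have -> : [set y | y \notin x :: ps] =
    [set y | y != x] `&` [set y | y \notin ps].
  by apply/seteqP; split=> y /=; rewrite inE negb_or => /andP.
by apply: openI => //; exact: point_complement_open.
Qed.

Variable m : nat.
Local Notation X := (proj_superspace K m).

Definition avoid (ps : seq X) : opens X := Opens (avoid_open ps).

Lemma avoid_cons (x : X) (ps : seq X) (y : X) :
  oset (avoid (x :: ps)) y <-> y != x /\ oset (avoid ps) y.
Proof. by rewrite /= inE negb_or; split=> /andP. Qed.

Lemma avoid_finite (s : seq K) z :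
  oset (avoid ([seq Some a | a <- s] : seq X)) (Some z : X) <-> z \notin s.
Proof. by rewrite /= mem_map // => ? ? []. Qed.

End PointComplements.

(** * A sheaf which does not split *)

Section NonSplit.
Variables (K : numClosedFieldType) (m : nat).
Hypothesis m3 : (2 < m)%N.
Local Notation X := (proj_superspace K m).

Let U1 : opens X := avoid [:: None : X].
Let U2 : opens X := avoid [:: Some 0 : X].
Let I : {set 'I_m} := [set i : 'I_m | (i < 3)%N].

Fact card_I : #|I| = 3.
Proof.
rewrite -sum1_card (eq_bigl (fun i : 'I_m => (i < 3)%N)); last first.
  by move=> i; rewrite inE.
by rewrite -(big_ord_widen _ (fun=> 1%N) m3) sum1_card card_ord.
Qed.

Fact charts_cover (x : X) : oset U1 x \/ oset U2 x.
Proof. by case: x => [z|]; [left|right]. Qed.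

Fact overlap_z z : oset (opens_meet U1 U2) (Some z) -> ('X : {poly K}).[z] != 0.
Proof.
by rewrite hornerX => -[_ /=]; rewrite inE; apply: contraNneq => ->.
Qed.

Fact overlap_oo : oset (opens_meet U1 U2) None ->
  (size (1%R : {poly K}) + 2 < size ('X : {poly K}))%N.
Proof. by move=> []. Qed.

(** theta_0 theta_1 theta_2 / z = psi_0 psi_1 psi_2 / w^2 has a pole at the
    origin of either chart. *)
Definition residue_function : osec (opens_meet U1 U2) :=
  rational_section card_I overlap_z overlap_oo.

(** A Laurent polynomial in z of the form a(z) - z^(-3) b(1/z) has no term in
    z^(-1). *)
Lemma not_pole (a b : {poly K}) :
  ~ forall z : K, z != 0 -> z^-1 + z ^- 3 * b.[z^-1] = a.[z].
Proof.
move=> ab; pose n := size b.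
have : reverse_poly n b * 'X + 'X^(n + 2) = 'X^(n + 3) * a.
  apply/eqP; rewrite -subr_eq0; apply/eqP;
    apply: (@poly_cofinite0 _ _ [:: 0]) => z.
  rewrite inE => z0; rewrite !(hornerD, hornerN, hornerM, hornerXn, hornerX).
  rewrite horner_reverse // -ab // !exprD.
  by move: (z ^+ n) b.[z^-1] => c B; field.
move=> /(congr1 (fun p : {poly K} => p`_(n + 2))).
rewrite coefD coefMX coefXn eqxx coefXnM ltn_add2l /= addn2 /= coef_poly.
by rewrite ltnNge leqnSn add0r => /eqP; rewrite oner_eq0.
Qed.

Lemma residue_not_split : exists E : pi_invertible_sheaf X, ~ pi_split E.
Proof.
have ho : odd_sec residue_function by apply: rational_section_odd.
exists (glued_pi_sheaf charts_cover ho (@proj_odd_squares K m)).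
move=> /glued_split[a [b [ha hb e]]].
have [az _ _] := proj_sectionP a; have [_ bw _] := proj_sectionP b.
have [|pa paE] := regular_polynomial _ (az I); first by [].
have [|pb pbE] := regular_polynomial _ (bw I).
  move=> w; rewrite /= /chart_w; have [//|w0] := eqVneq w 0.
  by rewrite inE; apply/eqP => -[/eqP]; rewrite invr_eq0 (negPf w0).
apply: (@not_pole pa pb) => z z0.
have z12 : z \in @chart_z K @^-1` (opens_meet U1 U2).
  by apply: mem_set; split=> //=; rewrite inE; apply/eqP => -[/eqP];
    rewrite (negPf z0).
have z1 : z \in @chart_z K @^-1` U1 by apply: mem_set; have [] := set_mem z12.
have z2 : z \in @chart_z K @^-1` U2 by apply: mem_set; have [] := set_mem z12.
have w2 : z^-1 \in @chart_w K @^-1` U2.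
  by apply: mem_set; rewrite /= /chart_w invr_eq0 (negPf z0) invrK;
    exact: set_mem z2.
pose p12 : @chart_z K @^-1` _ := exist _ z z12.
pose p1 : @chart_z K @^-1` U1 := exist _ z z1.
pose p2 : @chart_z K @^-1` U2 := exist _ z z2.
pose q2 : @chart_w K @^-1` U2 := exist _ z^-1 w2.
pose h := residue_function.
have bres : zpart (ores (@opens_meetr _ U1 U2) b) p12 = zpart b p2.
  rewrite [LHS]/(zpart b (chart_incl (@opens_meetr _ U1 U2) p12)).
  by congr zpart; apply: val_inj.
have ares : zpart (ores (@opens_meetl _ U1 U2) a) p12 = zpart a p1.
  rewrite [LHS]/(zpart a (chart_incl (@opens_meetl _ U1 U2) p12)).
  by congr zpart; apply: val_inj.
have {e} : zpart h p12 + zpart b p2 =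
    (1 - zpart b p2 * zpart h p12) * zpart a p1.
  rewrite -bres -ares.
  exact (congr1 (fun f : osec (opens_meet U1 U2) => zpart f p12) e).
rewrite mulrBl mul1r => /(congr1 (fun x => coef x I)).
rewrite !Defs.coefD Defs.coefN.
have -> : coef (zpart b p2 * zpart h p12 * zpart a p1) I = 0.
  have hh : order_ge 3 (zpart h p12).
    move=> J J3; rewrite rational_sectionE coef_monomial.
    by case: eqP J3 => // ->; rewrite card_I.
  have /homogeneous_pointwise[/(_ p1)/order_ge_odd a1 _] := ha.
  have /homogeneous_pointwise[/(_ p2)/order_ge_odd b1 _] := hb.
  by apply: (order_geM (order_geM b1 hh) a1); rewrite card_I.
rewrite rational_sectionE coef_monomial eqxx hornerC hornerX div1r subr0.
have -> : coef (zpart a p1) I = pa.[z] := paE p1.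
have <- : coef (wpart b q2) I = pb.[z^-1] := pbE q2.
have zq : val p2 * val q2 = 1 by rewrite /= divff.
rewrite (zwpart b zq) coef_rescale card_I /= mulKf ?expf_neq0 //.
Qed.

End NonSplit.

(** * Principal parts *)

Section PrincipalParts.
Variables (K : numClosedFieldType) (m : nat).
Local Notation X := (proj_superspace K m).
Implicit Types (U V W : opens X) (x : X).

Lemma poly_root_list (p : {poly K}) : p != 0 ->
  exists s : seq K, forall z, (z \notin s) = (p.[z] != 0).
Proof.
move=> p0; have [s hs] := poly_roots p0.
exists [seq z <- s | p.[z] == 0] => z; rewrite mem_filter negb_and.
by have [pz|//] := eqVneq p.[z] 0; apply: contraTF (introT eqP pz) => /hs.
Qed.

(** The first cohomology of O(-1) vanishes, by partial fractions: M1 / Q1 is the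
    principal part of P / Q at x. At a finite point it is a proper fraction and
    so vanishes at infinity; at infinity it is the polynomial part of P / Q,
    and the remainder is a proper fraction. Proper fractions are the rational
    functions that extend to infinity as sections of O(-1). *)
Lemma principal_part x (P Q : {poly K}) : Q != 0 ->
  exists M1 Q1 M2 Q2 : {poly K}, exists N : opens X,
  [/\ (forall z, oset (avoid [:: x]) (Some z) -> Q1.[z] != 0) /\
      (oset (avoid [:: x]) None -> (size M1 < size Q1)%N),
      oset N x,
      (forall z, oset N (Some z) -> Q2.[z] != 0) /\
      (oset N None -> (size M2 < size Q2)%N)
    & forall z, Q.[z] != 0 ->
        M1.[z] / Q1.[z] = P.[z] / Q.[z] + M2.[z] / Q2.[z]].
Proof.
move=> Q0; case: x => [a|].
  have [n [Q' Q'a QE]] := multiplicity_XsubC Q a; rewrite Q0 /= in Q'a.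
  set D := ('X - a%:P) ^+ n in QE.
  have D0 : D != 0 by rewrite expf_neq0 // polyXsubC_eq0.
  have Q'0 : Q' != 0 by apply: contraNneq Q0 => Q'0; rewrite QE Q'0 mul0r.
  have : coprimep Q' D.
    by rewrite /D coprimep_expr // coprimep_XsubC.
  move=> /Bezout_eq1_coprimepP[[u v] /= uv].
  have PE : P = (P * u) %% D * Q' + ((P * u) %/ D * Q' + P * v) * D.
    transitivity (P * u * Q' + P * (v * D)).
      by rewrite -mulrA -mulrDr uv mulr1.
    by rewrite [in LHS](divp_eq (P * u) D); ring.
  have [s hs] := poly_root_list Q'0.
  exists ((P * u) %% D), D, (- ((P * u) %/ D * Q' + P * v)), Q'.
  exists (@avoid K m (None :: [seq Some z | z <- s])); split.
  - split=> [z /=|_]; last by rewrite ltn_modp.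
    rewrite inE => za; rewrite horner_exp expf_neq0 // hornerXsubC subr_eq0.
    by apply: contraNneq za => ->.
  - by apply/avoid_cons; split=> //; apply/avoid_finite; rewrite hs.
  - by split=> [z|] /avoid_cons[// _ /avoid_finite]; rewrite hs.
  - move=> z Qz; have := Qz; rewrite QE hornerM mulf_eq0 negb_or => /andP[Q'z Dz].
    rewrite {2}PE !(hornerD, hornerM, hornerN).
    by field; rewrite Q'z Dz.
have [s hs] := poly_root_list Q0.
exists (P %/ Q), 1, (- (P %% Q)), Q, (@avoid K m [seq Some z | z <- s]); split.
- by split=> // z _; rewrite hornerE oner_eq0.
- by apply/mapP => -[].
- by split=> [z /avoid_finite|_]; rewrite ?hs ?size_polyN ?ltn_modp.
move=> z Qz; have -> : P.[z] = (P %/ Q).[z] * Q.[z] + (P %% Q).[z].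
  by rewrite -hornerM -hornerD -divp_eq.
by rewrite hornerN hornerC; field.
Qed.

Variables (x : X).

(** The invariant of an induction on the list l of coefficients treated so far:
    keeping the others zero leaves room for one more monomial. *)
Definition partial_solution (W N : opens X) (h : osec W)
    (r : osec (avoid [:: x])) (u : osec N) (l : seq {set 'I_m}) :=
  exists s : seq K, forall z (z1 : z \in @chart_z K @^-1` (avoid [:: x]))
    (zW : z \in @chart_z K @^-1` W) (zN : z \in @chart_z K @^-1` N) I,
    z \notin s ->
    if I \in l then
      coef (zpart r (exist _ z z1)) I =
        coef (zpart h (exist _ z zW)) I + coef (zpart u (exist _ z zN)) I
    else coef (zpart r (exist _ z z1)) I = 0 /\
         coef (zpart u (exist _ z zN)) I = 0.

Lemma partial_solution_exists (W : opens X) y (h : osec W)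
    (l : seq {set 'I_m}) :
  oset W y -> uniq l -> all (fun I : {set 'I_m} => #|I| == 1%N) l ->
  exists (r : osec (avoid [:: x])) (N : opens X) (u : osec N),
    [/\ odd_sec r, odd_sec u, oset N x & partial_solution h r u l].
Proof.
move=> Wy; elim: l => [_ _|I0 l IH /= /andP[I0l ul] /andP[/eqP I01 al]].
  exists 0, (@avoid K m [::]), 0; split=> //; try exact: homogeneous0.
  by exists [::] => z z1 zW zN I _; rewrite !Defs.coef0.
have [r [N [u [hr hu Nx [s rhu]]]]] := IH ul al.
have [P [Q [Q0 hE]]] := section_rational h I0 Wy.
have [M1 [Q1 [M2 [Q2 [N1 [[Q1z Q1oo] N1x [Q2z Q2oo] e]]]]]] :=
  principal_part x P Q0.
have [t ht] := poly_root_list Q0.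
have Q1oo' : oset (avoid [:: x]) None -> (size M1 + 0 < size Q1)%N.
  by rewrite addn0.
pose N' := opens_meet N N1.
have Q2z' z : oset N' (Some z) -> Q2.[z] != 0 by move=> [_ /Q2z].
have Q2oo' : oset N' None -> (size M2 + 0 < size Q2)%N.
  by rewrite addn0 => -[_ /Q2oo].
pose r1 := rational_section I01 Q1z Q1oo'.
pose u1 := rational_section I01 Q2z' Q2oo'.
exists (r + r1), N', (ores (@opens_meetl _ N N1) u + u1); split=> //.
- by apply: homogeneousD => //; apply: (rational_section_odd I01 Q1z Q1oo').
- apply: homogeneousD; last exact: (rational_section_odd I01 Q2z' Q2oo').
  exact: (homogeneous_res (@opens_meetl _ N N1) hu).
exists (s ++ t) => z z1 zW zN' I; rewrite mem_cat negb_or => /andP[zs zt].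
have Qz : Q.[z] != 0 by rewrite -ht.
have zN : z \in @chart_z K @^-1` N by apply: mem_set; have [] := set_mem zN'.
pose p1 : @chart_z K @^-1` (avoid [:: x]) := exist _ z z1.
pose pN' : @chart_z K @^-1` N' := exist _ z zN'.
pose pN : @chart_z K @^-1` N := exist _ z zN.
have rE : zpart (r + r1) p1 = zpart r p1 + monomial I0 (M1.[z] / Q1.[z]) by [].
have uE : zpart (ores (@opens_meetl _ N N1) u + u1) pN' =
    zpart u pN + monomial I0 (M2.[z] / Q2.[z]).
  rewrite [LHS]/(zpart u (chart_incl (@opens_meetl _ N N1) pN') + _).
  by congr (zpart u _ + _); apply: val_inj.
rewrite rE uE !Defs.coefD !coef_monomial inE.
have := rhu z z1 zW zN I zs; have [->|I0I] := eqVneq I I0; last first.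
  by rewrite !addr0.
rewrite (negPf I0l) /= => -[-> ->]; rewrite !add0r e //.
by rewrite (hE (exist _ z zW)).
Qed.

(** When m <= 2 an odd function only has coefficients of degree 1, which are
    sections of O(-1): take principal parts coefficientwise. *)
Lemma odd_principal_part (W : opens X) y (h : osec W) : (m <= 2)%N ->
  oset W y -> odd_sec h ->
  exists (r : osec (avoid [:: x])) (N : opens X) (u : osec N),
    [/\ odd_sec r, odd_sec u, oset N x
      & forall (T : opens X) (T1 : T `<=` avoid [:: x]) (TW : T `<=` W)
          (TN : T `<=` N), ores T1 r = ores TW h + ores TN u].
Proof.
move=> m2 Wy ho.
have [|r [N [u [hr hu Nx [s rhu]]]]] := @partial_solution_exists W y h
  (enum [pred I : {set 'I_m} | #|I| == 1%N]) Wy (enum_uniq _).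
  by apply/allP => I; rewrite mem_enum inE.
exists r, N, u; split=> // T T1 TW TN.
apply: (@section_eq _ _ T _ _ s) => -[z zT] zs; apply: extP => I.
pose pT : @chart_z K @^-1` T := exist _ z zT.
rewrite [in RHS]/zpart.
have -> : coef (zpart (ores TW h + ores TN u) pT) I =
    coef (zpart h (chart_incl TW pT)) I + coef (zpart u (chart_incl TN pT)) I.
  exact: Defs.coefD.
have -> : zpart (ores T1 r) pT = zpart r (chart_incl T1 pT) by [].
have := rhu z (chart_incl_subproof T1 pT) (chart_incl_subproof TW pT)
  (chart_incl_subproof TN pT) I zs.
rewrite mem_enum inE; case: eqP => [_ e|I1 [e1 e2]]; first exact: e.
have -> : coef (zpart r (chart_incl T1 pT)) I = 0 := e1.
have -> : coef (zpart u (chart_incl TN pT)) I = 0 := e2.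
rewrite addr0.
have /homogeneous_pointwise[/(_ (chart_incl TW pT))/(ext_evP true) hI _] := ho.
rewrite hI //; apply: contra_notN I1 => oI.
have : (#|I| <= 2)%N by rewrite (leq_trans _ m2) // -[leqRHS]card_ord max_card.
by case: #|I| oI => [|[|[|]]].
Qed.

End PrincipalParts.

(** * Splitting on projective superlines with at most two odd coordinates *)

Section SplitSmall.
Variables (K : numClosedFieldType) (m : nat).
Hypothesis m2 : (m <= 2)%N.
Local Notation X := (proj_superspace K m).

(** The principal part at one point is regular at the others, so that the
    solutions for the individual points add up. *)
Lemma odd_principal_parts (ps : seq X) (W : X -> opens X)
    (h : forall p, osec (W p)) :
  uniq ps -> (forall p, exists y, oset (W p) y) -> (forall p, odd_sec (h p)) ->
  exists2 r : osec (avoid ps), odd_sec r & forall p, p \in ps ->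
    exists (N : opens X) (u : osec N), [/\ odd_sec u, oset N p
      & forall (T : opens X) (T1 : T `<=` avoid ps) (TW : T `<=` W p)
          (TN : T `<=` N), ores T1 r = ores TW (h p) + ores TN u].
Proof.
move=> + Wne ho; elim: ps => [_|x ps IH]; last rewrite cons_uniq.
  by exists 0 => //; exact: homogeneous0.
move=> /andP[xps ups].
have [r0 hr0 r0E] := IH ups; have [y Wy] := Wne x.
have [r1 [N1 [u1 [hr1 hu1 N1x r1E]]]] := odd_principal_part x m2 Wy (ho x).
have sub0 : avoid (x :: ps) `<=` avoid ps.
  by move=> z /avoid_cons[].
have sub1 : avoid (x :: ps) `<=` avoid [:: x].
  by move=> z /avoid_cons[zx _]; apply/avoid_cons.
exists (ores sub0 r0 + ores sub1 r1).
  apply: homogeneousD; [exact: (homogeneous_res sub0 hr0)|].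
  exact: (homogeneous_res sub1 hr1).
move=> p; rewrite inE => /orP[/eqP ->|pps].
  exists (opens_meet N1 (avoid ps)).
  exists (ores (@opens_meetl _ _ _) u1 + ores (@opens_meetr _ _ _) r0);
    split=> //.
    apply: homogeneousD; [exact: (homogeneous_res _ hu1)|].
    exact: (homogeneous_res _ hr0).
  move=> T T1 TW TN; rewrite (rmorphD (ores T1)) (rmorphD (ores TN)).
  rewrite !(ores_comp _ _ (subset_trans T1 sub0)).
  rewrite !(ores_comp _ _ (subset_trans T1 sub1)).
  rewrite !(ores_comp _ _ (subset_trans TN (@opens_meetl _ _ _))).
  by rewrite (r1E T _ TW (subset_trans TN (@opens_meetl _ _ _))) addrC addrA.
have [N [u [hu Np uE]]] := r0E p pps.
exists (opens_meet N (avoid [:: x])).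
exists (ores (@opens_meetl _ _ _) u + ores (@opens_meetr _ _ _) r1); split=> //.
- apply: homogeneousD; [exact: (homogeneous_res _ hu)|].
  exact: (homogeneous_res _ hr1).
- by split=> //; apply/avoid_cons; split=> //; apply: contraNneq xps => <-.
move=> T T1 TW TN; rewrite (rmorphD (ores T1)) (rmorphD (ores TN)).
rewrite !(ores_comp _ _ (subset_trans T1 sub0)).
rewrite !(ores_comp _ _ (subset_trans T1 sub1)).
rewrite !(ores_comp _ _ (subset_trans TN (@opens_meetl _ _ _))).
by rewrite (uE T _ TW (subset_trans TN (@opens_meetl _ _ _))) addrA.
Qed.

Lemma pi_split_le2 (E : pi_invertible_sheaf X) : pi_split E.
Proof.
have sq0 := @proj_odd_squares K m.
have gens := pi_generator_exists (pi_sym E) sq0 (pi_rank E).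
pose U x := projT1 (cid (gens x)).
have hU x : oset (U x) x /\ exists e : E (U x), pi_generator (pi_sym E) e.
  exact: projT2 (cid (gens x)).
have [e ge] : exists e : forall x, E (U x), forall x, pi_generator (pi_sym E)
  (e x).
  by exists (fun x => projT1 (cid (hU x).2)) => x; exact: projT2 (cid (hU x).2).
have Ux x : oset (U x) x := (hU x).1.
have [s hs] := opens_cofinite (Ux None).
pose ps : seq X := undup (None :: [seq Some z | z <- s]).
pose U0 : opens X := avoid ps.
have U0s z : z \notin s -> oset U0 (Some z).
  move=> zs; rewrite /U0 /= mem_undup inE /= mem_map // => ? ? [].
have U0U : U0 `<=` U None.
  move=> [z|]; rewrite /U0 /= mem_undup inE //= mem_map => [|? ? []//].
  exact: hs.
(* the generator near infinity is the reference on all of U0 *)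
pose e0 := mres U0U (e None).
have ge0 : pi_generator (pi_sym E) e0 := pi_generator_res U0U (ge None).
pose W x := opens_meet (U x) U0.
have ratio x := pi_generator_ratio sq0
  (pi_generator_res (@opens_meetr _ (U x) U0) ge0)
  (pi_generator_res (@opens_meetl _ (U x) U0) (ge x)).
pose g x := projT1 (cid (ratio x)).
pose h x := projT1 (cid (projT2 (cid (ratio x)))).
have gh x : [/\ even_sec (g x), odd_sec (h x) &
    mres (@opens_meetl _ (U x) U0) (e x) =
    g x *: comb (pi_sym E) (mres (@opens_meetr _ (U x) U0) e0) 1 (h x)].
  exact: projT2 (cid (projT2 (cid (ratio x)))).
have [||r hr rE] := @odd_principal_parts ps W h (undup_uniq _).
- move=> p; have [t ht] := opens_cofinite (Ux p).
  have [z] := infinite_avoid (s ++ t); rewrite mem_cat negb_or => /andP[zs zt].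
  by exists (Some z); split; [exact: ht|exact: U0s].
- by move=> p; case: (gh p).
have [z0 z0s] := infinite_avoid s.
apply: (split_of_shifts sq0 (proj_odd_cubes m2)
  (fun V => @res_dense K m V U0 (Some z0) (U0s z0 z0s)) ge0 hr) => x.
have [xps|xps] := boolP (x \in ps); last first.
  exists U0; split=> //; exists e0, r, 1, 0; split=> //.
  - by split; [exact: sring_1even|exact: homogeneous0].
  - by rewrite comb10 scale1r (Prop_irrelevance (@opens_meetl _ U0 U0)
    (@opens_meetr _ U0 U0)).
  - by rewrite add0r (Prop_irrelevance (@opens_meetl _ U0 U0) (@opens_meetr _
    U0 U0)).
have [N [u [hu Nx uE]]] := rE x xps; have [hg hh eE] := gh x.
pose V := opens_meet N (U x); pose VN := @opens_meetl _ N (U x).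
pose VU := @opens_meetr _ N (U x); pose T := opens_meet V U0.
have TW : T `<=` W x by move=> y [[]].
exists V; split=> //;
  exists (mres VU (e x)), (ores VN u), (ores TW (g x)), (ores TW (h x)).
split; [exact: pi_generator_res|exact: homogeneous_res| | |].
- by split; apply: homogeneous_res.
- rewrite (mres_comp _ _ (subset_trans (@opens_meetl _ V U0) VU)).
  rewrite -(mres_comp (@opens_meetl _ (U x) U0) TW) eE mres_scale mres_comb
    rmorph1.
  by rewrite (mres_comp _ _ (@opens_meetr _ V U0)).
rewrite (ores_comp _ _ (subset_trans (@opens_meetl _ V U0) VN)).
exact: uE.
Qed.

End SplitSmall.

Theorem corollary2 (R : realType) (m : nat) :
  (exists E : pi_invertible_sheaf (proj_superspace (complex R) m),
     ~ pi_split E)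
  <-> (2 < m)%N.
Proof.
split=> [[E nE]|m3]; last exact: (@residue_not_split (complex R) m m3).
by rewrite ltnNge; apply/negP => m2; apply: nE; exact: (@pi_split_le2 (complex R)).
Qed.
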